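(* Let $c>0$ be real and let $n\ge\frac{2c}{\pi}-1$ be a nonnegative integer. Then $$2\,\lambda_n(c)\ \ge\ \Gamma_2\left(n,\frac{4c}{n+1}\right),$$ or, equivalently, for $0<\varepsilon<2\pi$, $$\Gamma_2(n,\varepsilon)\ \le\ 2\,\lambda_n\left(\frac{n+1}{4}\,\varepsilon\right).$$ In particular, for $0<\varepsilon<4$ and every integer $n\ge 33$, $$\Gamma_2(n,\varepsilon)\ \le\ \exp\left(-\frac{n}{32}\log\frac{4}{\varepsilon}\right).$$
   Context: For $c>0$, $\mathcal{Q}_c$ is the operator on $L^2([-1,1])$ defined by $\mathcal{Q}_c f(x)=\int_{-1}^1\frac{\sin c(y-x)}{\pi(y-x)}f(y)\,dy$ (the kernel being $c/\pi$ at $y=x$). It is self-adjoint, positive and compact; its eigenvalues are simple and are listed in decreasing order $\lambda_0(c)>\lambda_1(c)>\cdots>\lambda_n(c)>\cdots$, $n\ge 0$. For an integer $n\ge 0$ and $0<\varepsilon\le 2\pi$, $\Gamma_2(n,\varepsilon)$ denotes the best (i.e. largest) constant such that $$\int_I|P(e^{it})|^2\,dt\ \ge\ \Gamma_2(n,\varepsilon)\int_0^{2\pi}|P(e^{it})|^2\,dt$$ for every polynomial $P(z)=\sum_{k=0}^n a_kz^k$ with complex coefficients of degree at most $n$ and every interval $I\subset\mathbb{R}$ of length $\varepsilon$. $\log$ is the natural logarithm. *)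

(* Defs.v *)
From HB Require Import structures.
From mathcomp Require Import all_boot all_order all_algebra.
From mathcomp Require Import all_classical all_reals all_analysis.
From mathcomp Require Import measurable_realfun complex ring lra.

Set Implicit Arguments.
Unset Strict Implicit.
Unset Printing Implicit Defensive.
Import Order.TTheory GRing.Theory Num.Theory.
Import numFieldNormedType.Exports.

Local Open Scope classical_set_scope.
Local Open Scope ring_scope.
Local Open Scope complex_scope.

(* Functions on [-1, 1] are represented by functions R -> R, of which only the
   values in [-1, 1] matter: membership in L^2 is tested on the extension by 0,
   and equality is almost everywhere in [-1, 1]. The kernel being real, it is
   enough to consider real-valued functions: the eigenvalues and their
   multiplicities are the same over R and over C. *)

Definition L2I (R : realType) : set (R -> R) :=
  [set f | f \_ `[-1, 1]%classic \in Lfun lebesgue_measure 2%:E].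

Definition eqI (R : realType) (f g : R -> R) : Prop :=
  ae_eq lebesgue_measure `[-1, 1]%classic f g.

Definition sinc_kernel (R : realType) (c x y : R) : R :=
  if y == x then c / pi else sin (c * (y - x)) / (pi * (y - x)).

Definition Qop (R : realType) (c : R) (f : R -> R) (x : R) : R :=
  \int[lebesgue_measure]_(y in `[-1, 1]%classic) (sinc_kernel c x y * f y).

Definition in_eigenspace (R : realType) (c m : R) (f : R -> R) : Prop :=
  L2I f /\ eqI (Qop c f) (fun x => m * f x).

Definition Qeigenvalue (R : realType) (c m : R) : Prop :=
  exists2 f : R -> R, in_eigenspace c m f & ~ eqI f (cst 0).

Definition lin_indepI (R : realType) (k : nat) (f : 'I_k -> R -> R) : Prop :=
  forall a : 'I_k -> R,
    eqI (fun x => \sum_(i < k) a i * f i x) (cst 0) -> forall i, a i = 0.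

(* The eigenvalue of index n (from 0) in the decreasing list of eigenvalues,
   counted with multiplicity: the largest eigenvalue m such that at least n + 1
   eigenvalues are >= m. *)
Definition lambda (R : realType) (c : R) (n : nat) : R :=
  sup [set m | Qeigenvalue c m /\
    exists2 f : 'I_n.+1 -> R -> R, lin_indepI f &
      forall i, exists2 m', m <= m' & in_eigenspace c m' (f i)].

Definition sqnorm_circle (R : realType) (P : {poly R[i]}) (t : R) : R :=
  Normc.normc P.[cos t +i* sin t] ^+ 2.

Definition Gamma2 (R : realType) (n : nat) (eps : R) : R :=
  sup [set C | forall P : {poly R[i]}, (size P <= n.+1)%N -> forall a : R,
    C * \int[lebesgue_measure]_(t in `[0, 2 * pi]%classic) sqnorm_circle P t <=
    \int[lebesgue_measure]_(t in `[a, a + eps]%classic) sqnorm_circle P t].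

Section LambdaListing.
Context (R : realType).
Implicit Types (c m x y : R) (f g : R -> R).
Let mu : {measure set _ -> \bar R} := @lebesgue_measure R.
Let D : set R := `[-1, 1]%classic.

Let mD : measurable (D : set (measurableTypeR R)).
Proof. exact: measurable_itv. Qed.

Lemma sin_le_abs y : `|sin y| <= `|y|.
Proof.
wlog y0 : y / 0 <= y.
  move=> h; have [/h //|y0] := leP 0 y.
  by rewrite -normrN -sinN -[X in _ <= X]normrN h // oppr_ge0 ltW.
have [->|y1] := eqVneq y 0; first by rewrite sin0.
have yp : 0 < y by rewrite lt0r y1.
have sc : {within `[0, y], continuous (@sin R)}.
  by apply: continuous_subspaceT => x; exact: continuous_sin.
have [z zin] := @MVT R sin cos 0 y yp (fun x _ => is_derive_sin x) sc.
rewrite sin0 !subr0 => ->; rewrite normrM ler_piMl // ler_norml.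
by rewrite cos_geN1 cos_le1.
Qed.

Lemma kernel_bound c x y : `|sinc_kernel c x y| <= `|c| / pi.
Proof.
rewrite /sinc_kernel; case: eqVneq => [_|yx].
  by rewrite normrM normfV (ger0_norm (pi_ge0 R)).
have p0 := pi_gt0 R.
rewrite normrM normfV normrM (gtr0_norm p0) invfM mulrA [X in X <= _]mulrAC.
rewrite ler_pM2r ?invr_gt0 // ler_pdivrMr ?normr_gt0 ?subr_eq0 //.
by rewrite -normrM sin_le_abs.
Qed.

Lemma measurable_kernel c x : measurable_fun setT (sinc_kernel c x).
Proof.
pose A : set R := [set y | y != x].
have oA : open A by exact: open_neq.
have mA : measurable A by exact: open_measurable.
rewrite [X in measurable_fun _ X](_ : _ =
   (fun y => if y == x then c / pi else
      ((fun y => sin (c * (y - x)) / (pi * (y - x))) \_ A) y)); last first.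
  apply/funext => y; rewrite /sinc_kernel; case: eqVneq => // yx.
  by rewrite patchE mem_set.
apply: measurable_fun_ifT => //.
  by apply: measurable_fun_eqr.
apply/(measurable_restrictT _ mA).
apply: open_continuous_measurable_fun.
  exact: oA.
move=> y; rewrite inE => /= yx; have yx' : y - x != 0 by rewrite subr_eq0.
have h : {for y, continuous (fun t => t - x)}.
  by apply: cvgB; [exact: cvg_id|exact: cvg_cst].
apply: cvgM.
  apply: continuous_comp; last exact: continuous_sin.
  by apply: cvgM => //; exact: cvg_cst.
apply: cvgV; first by rewrite mulf_neq0 // gt_eqF // pi_gt0.
by apply: cvgM => //; exact: cvg_cst.
Qed.

Lemma kernel_integrable c x f : L2I f ->
  mu.-integrable D (EFin \o (fun y => sinc_kernel c x y * f y)).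
Proof.
move=> L2f.
have mf : measurable_fun D f.
  apply/(measurable_restrictT _ mD).
  by move: L2f; rewrite /L2I /= inE => /andP[]; rewrite inE.
have if2 : mu.-integrable D (EFin \o (fun y => f y ^+ 2)).
  apply/(integrable_mkcond _ mD).
  have := Lfun2_integrable_sqr L2f.
  apply: eq_integrable => // y _; rewrite /= !patchE; case: ifP => // _.
  by rewrite expr0n.
have i1 : mu.-integrable D (EFin \o cst (1 : R)).
  apply: continuous_compact_integrable; first exact: segment_compact.
  by apply: continuous_subspaceT => z; exact: cvg_cst.
have ib : mu.-integrable D (EFin \o (fun y => (`|c| / pi) * (1 + f y ^+ 2))).
  have := integrableZl mD (`|c| / pi) (integrableD mD i1 if2).
  by apply: eq_integrable.
apply: (le_integrable mD _ _ ib).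
  apply/measurable_EFinP; apply: measurable_funM => //.
  by apply: measurable_funTS; exact: measurable_kernel.
move=> y _; rewrite /= lee_fin normrM.
have p0 := pi_gt0 R.
have h0 : 0 <= `|c| / pi by apply: divr_ge0 => //; exact: ltW p0.
have h1 : 0 <= 1 + f y ^+ 2 by rewrite addr_ge0 ?sqr_ge0.
rewrite [leRHS]ger0_norm; last exact: mulr_ge0.
apply: ler_pM => //; first exact: kernel_bound.
rewrite -(real_normK (num_real (f y))); set t := `|f y|.
have := sqr_ge0 (t - 1); nra.
Qed.

Lemma Qop_sum c (k : nat) (a : 'I_k -> R) (f : 'I_k -> R -> R) x :
  (forall i, L2I (f i)) ->
  mu.-integrable D (EFin \o (fun y => sinc_kernel c x y * \sum_(i < k) a i * f i y)) /\
  Qop c (fun y => \sum_(i < k) a i * f i y) x = \sum_(i < k) a i * Qop c (f i) x.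
Proof.
move=> Lf; elim: k a f Lf => [|k ih] a f Lf.
  have e : (fun y => sinc_kernel c x y * \sum_(i < 0) a i * f i y) = cst 0.
    by apply/funext => y; rewrite big_ord0 mulr0.
  rewrite /Qop e; split; first exact: integrable0.
  by rewrite /Rintegral big_ord0 integral0.
have [i1 e1] := ih (fun i => a (widen_ord (leqnSn k) i))
                   (fun i => f (widen_ord (leqnSn k) i)) (fun i => Lf _).
have i2 := kernel_integrable c x (Lf ord_max).
have i3 : mu.-integrable D
    (EFin \o (fun y => a ord_max * (sinc_kernel c x y * f ord_max y))).
  by have := integrableZl mD (a ord_max) i2; exact: eq_integrable.
have e : (fun y => sinc_kernel c x y * \sum_(i < k.+1) a i * f i y) =
   (fun y => sinc_kernel c x y * (\sum_(i < k) a (widen_ord (leqnSn k) i) *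
        f (widen_ord (leqnSn k) i) y) + a ord_max * (sinc_kernel c x y * f ord_max y)).
  by apply/funext => y; rewrite big_ord_recr mulrDr; congr (_ + _); ring.
rewrite /Qop e; split.
  by have := integrableD mD i1 i3; exact: eq_integrable.
by rewrite RintegralD // RintegralZl // -/(Qop _ _ _) e1 big_ord_recr.
Qed.

Lemma Qop_ae0 c (k : nat) (a : 'I_k -> R) (f : 'I_k -> R -> R) x :
  (forall i, L2I (f i)) ->
  eqI (fun y => \sum_(i < k) a i * f i y) (cst 0) ->
  \sum_(i < k) a i * Qop c (f i) x = 0.
Proof.
move=> Lf s0; have [i1 <-] := Qop_sum c a x Lf.
rewrite /Qop /Rintegral (ae_eq_integral (cst 0%E)) ?integral0 //.
  by case/integrableP: i1.
by apply: filterS s0 => y h /h /= ->; rewrite mulr0.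
Qed.

Lemma eigen_step c (k : nat) (l : 'I_k -> R) (a : 'I_k -> R) (f : 'I_k -> R -> R) :
  (forall i, in_eigenspace c (l i) (f i)) ->
  eqI (fun y => \sum_(i < k) a i * f i y) (cst 0) ->
  eqI (fun y => \sum_(i < k) (a i * l i) * f i y) (cst 0).
Proof.
move=> ef s0.
have h : \forall y \ae (@lebesgue_measure R), forall i : 'I_k, D y -> Qop c (f i) y = l i * f i y.
  by apply: filter_forall => i; exact: (ef i).2.
apply: filterS h; first exact: (ae_filter_ringOfSetsType mu).
move=> y h Dy; rewrite /= -[RHS](Qop_ae0 c y (fun i => (ef i).1) s0).
by apply: eq_bigr => i _; rewrite h // mulrA.
Qed.

Lemma eigen_prod c (k : nat) (l : 'I_k -> R) (a : 'I_k -> R) (f : 'I_k -> R -> R) (s : seq R) :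
  (forall i, in_eigenspace c (l i) (f i)) ->
  eqI (fun y => \sum_(i < k) a i * f i y) (cst 0) ->
  eqI (fun y => \sum_(i < k) (a i * \prod_(r <- s) (l i - r)) * f i y) (cst 0).
Proof.
move=> ef s0; elim: s => [|r s ih].
  by under eq_fun do under eq_bigr do rewrite big_nil mulr1.
have h := eigen_step ef ih.
move: h; apply: filterS2 ih => y ih h Dy.
have {}h := h Dy; have {}ih := ih Dy; rewrite /= in h ih *.
transitivity ((\sum_(i < k) a i * \prod_(j <- s) (l i - j) * l i * f i y) - r *
   (\sum_(i < k) a i * \prod_(j <- s) (l i - j) * f i y)).
  by rewrite mulr_sumr -sumrB; apply: eq_bigr => i _; rewrite big_cons; ring.
by rewrite h ih mulr0 subr0.
Qed.

Lemma eigen_indep c (k : nat) (l : 'I_k -> R) (f : 'I_k -> R -> R) :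
  injective l -> (forall i, in_eigenspace c (l i) (f i)) ->
  (forall i, ~ eqI (f i) (cst 0)) -> lin_indepI f.
Proof.
move=> inj ef fn0 a s0 j; apply: contrapT => /eqP aj.
apply: (fn0 j).
pose s := [seq l i | i <- enum 'I_k & i != j].
pose p i := \prod_(r <- s) (l i - r).
have := eigen_prod s ef s0.
have pj : p j != 0.
  rewrite /p /s big_map big_filter big_enum_cond; apply/prodf_neq0 => i /andP[_ ij].
  by rewrite subr_eq0; apply: contra_neq ij => e; apply: inj.
have pi0 i : i != j -> p i = 0.
  move=> ij; rewrite /p /s big_map big_filter big_enum_cond (bigD1 i) //=.
  by rewrite subrr mul0r.
apply: filterS => y /[apply] /=.
rewrite (bigD1 j) //= [X in _ + X]big1 => [|i ij]; last first.
  by rewrite -/(p i) pi0 // mulr0 mul0r.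
rewrite addr0 -/(p j) => /eqP; rewrite !mulf_eq0 (negbTE aj) (negbTE pj) /=.
by move/eqP.
Qed.

(* When every eigenvalue is simple, lambda c is the enumeration of the set of
   eigenvalues in strictly decreasing order. *)
Lemma lambda_listing c (l : nat -> R) :
  (forall n, l n.+1 < l n) ->
  (forall m, Qeigenvalue c m <-> exists n, m = l n) ->
  (forall m f g, in_eigenspace c m f -> in_eigenspace c m g ->
     ~ eqI f (cst 0) -> exists a, eqI g (fun x => a * f x)) ->
  forall n, lambda c n = l n.
Proof.
move=> ldec lspec lsimple n.
have lanti : {homo l : i j / (i < j)%N >-> j < i}.
  apply: homo_ltn => // x y z; first by move=> h1 h2; exact: lt_trans h2 h1.
have linj : injective l.
  move=> i j; case: (ltngtP i j) => // /lanti; [|move=>+ e]; last by rewrite e ltxx.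
  by move=> + e; rewrite e ltxx.
have psi i : exists f, in_eigenspace c (l i) f /\ ~ eqI f (cst 0).
  have [|f ? ?] := (lspec (l i)).2; first by exists i.
  by exists f.
have {psi} [psi psiP] := choice psi.
rewrite /lambda; set S := [set m | _].
have Sln : S (l n).
  split; first by apply/lspec; exists n.
  exists (fun i : 'I_n.+1 => psi i).
    apply: (@eigen_indep c _ (fun i => l (nat_of_ord i))).
    - by move=> i j /linj/val_inj.
    - by move=> i; exact: (psiP i).1.
    - by move=> i; exact: (psiP i).2.
  move=> i; exists (l i); last exact: (psiP i).1.
  by have := ltn_ord i; rewrite ltnS leq_eqVlt => /orP[/eqP->//|/lanti/ltW].
have Sub : ubound S (l n).
  move=> m [_ [f find fP]]; rewrite leNgt; apply/negP => lm.
  have fn0 i : ~ eqI (f i) (cst 0).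
    move=> fi0; have := find (fun j => (j == i)%:R) _ i.
    rewrite eqxx => h; suff /h/eqP : eqI (fun x => \sum_(j < n.+1) (j == i)%:R * f j x) (cst 0).
      by rewrite oner_eq0.
    apply: filterS fi0 => y /[apply] /= fi0.
    rewrite (bigD1 i) //= eqxx mul1r fi0 add0r big1 // => j ji.
    by rewrite (negbTE ji) mul0r.
  have idx i : exists j : 'I_n, in_eigenspace c (l j) (f i).
    have [m' mm' efi] := fP i.
    have /lspec[j mj] : Qeigenvalue c m' by exists (f i).
    suff jn : (j < n)%N by exists (Ordinal jn); rewrite -mj.
    rewrite ltnNge; apply/negP; rewrite leq_eqVlt => /orP[/eqP nj|/lanti nj].
      by move: (lt_le_trans lm mm'); rewrite mj nj ltxx.
    by move: (lt_trans nj (lt_le_trans lm mm')); rewrite mj ltxx.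
  have [g gP] := choice idx.
  have /injectivePn[i [j ij gij]] : ~~ injectiveb g.
    apply/negP => /injectiveP /leq_card; by rewrite !card_ord ltnn.
  have gj := gP j; rewrite -gij in gj.
  have [a fa] := lsimple _ _ _ (gP i) gj (fn0 i).
  pose b t : R := if t == j then 1 else if t == i then - a else 0.
  have := find b _ j.
  rewrite {2}/b eqxx => h; suff /h/eqP : eqI (fun x => \sum_(t < n.+1) b t * f t x) (cst 0).
    by rewrite oner_eq0.
  rewrite /b; apply: filterS fa => y /[apply] /= fa.
  rewrite (bigD1 j) //= eqxx mul1r (bigD1 i) //= (negbTE ij) eqxx fa big1.
    by ring.
  by move=> t /andP[/negbTE-> /negbTE->]; rewrite mul0r.
apply/eqP; rewrite eq_le; apply/andP; split.
  by apply: ge_sup => //; exists (l n).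
by apply: ub_le_sup => //; exists (l n).
Qed.
End LambdaListing.

(* Main.v *)
(** Both bounds come from trial functions.

    For the comparison with the prolate eigenvalues, a polynomial with real
    coefficients [a_0, ..., a_n] is turned into the function on [[-1, 1]] that
    equals [a_j * cos (pi * (x - x_j) / h)] on the [j]-th of [n + 1] adjacent
    intervals of length [h = 2 / (n + 1)] and centre [x_j]. Its Fourier transform
    at [t] has modulus [h * A (h * t) * |P (e^{iht})|], where [A] is the Fourier
    transform of the half-period of the cosine. As [A >= 1/2] on [[0, pi]], while
    the squared norm is [h / 2 * sum a_j^2], Parseval's identity on the circle gives
    [<Q f, f> >= Gamma_2 / 2 * |f|^2] on a space of dimension [n + 1]; indicator
    functions instead of cosines would give [pi^2 / 4] in place of [2].

    The max-min principle is obtained as follows. From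
    [K (x, y) = 1/pi * int_0^c cos ((y - x) * t) dt], the form [<Q f, f>] is the
    integral over [[0, c]] of a sum of two squares, so [Q] is symmetric and
    positive. If [M] is the supremum of [<Q f, f>] over unit vectors of an invariant
    subspace, then [|Q f - M f|^2 <= M * (M - <Q f, f>)]; the functions [Q f] are
    uniformly bounded and Lipschitz, so by Tychonoff's theorem they cluster
    uniformly at some [g] when [<Q f, f>] tends to [M], and [Q g = M g].
    Repeating this on the orthogonal complement of the eigenfunctions already
    found gives [n + 1] of them. Everything takes place among bounded measurable
    functions, so the completeness of [L^2] plays no role.

    The last bound uses [P = (X - 1)^n] and the interval of length [eps] centred
    at [0], where [|P (e^{it})|^2 = (4 * sin (t/2)^2)^n]. *)
Require Import Defs.
From HB Require Import structures.
From mathcomp Require Import all_boot all_order all_algebra.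
From mathcomp Require Import all_classical all_reals all_analysis.
From mathcomp Require Import measurable_realfun complex ring lra.
Import Order.TTheory GRing.Theory Num.Theory.
Import numFieldNormedType.Exports.

Set Implicit Arguments.
Unset Strict Implicit.
Unset Printing Implicit Defensive.
Local Open Scope classical_set_scope.
Local Open Scope ring_scope.

(** * Integrals of bounded measurable functions *)

Section BoundedMeasurable.
Context (R : realType).
Implicit Types (f g : R -> R) (a b c r : R).
Let mu : {measure set _ -> \bar R} := @lebesgue_measure R.

(** Both conditions are imposed on the whole line, not only on [[-1, 1]]: the class is stable under
    sums and products, and its members are integrable on every segment. *)
Definition bmeas f :=
  measurable_fun setT f /\ exists B : R, forall x, `|f x| <= B.

Lemma bmeas_cst r : bmeas (cst r).
Proof. by split=> //; exists `|r|. Qed.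

Lemma bmeasD f g : bmeas f -> bmeas g -> bmeas (fun x => f x + g x).
Proof.
move=> [mf [B fB]] [mg [C gC]]; split; first exact: measurable_funD.
by exists (B + C) => x; apply: le_trans (ler_normD _ _) _; exact: lerD.
Qed.

Lemma bmeasM f g : bmeas f -> bmeas g -> bmeas (fun x => f x * g x).
Proof.
move=> [mf [B fB]] [mg [C gC]]; split; first exact: measurable_funM.
by exists (B * C) => x; rewrite normrM ler_pM.
Qed.

Lemma bmeasZ r f : bmeas f -> bmeas (fun x => r * f x).
Proof. by move=> bf; apply: bmeasM => //; exact: bmeas_cst. Qed.

Lemma bmeasN f : bmeas f -> bmeas (fun x => - f x).
Proof.
by move=> /(bmeasZ (-1)); congr bmeas; apply/funext => x; rewrite mulN1r.
Qed.

Lemma bmeasB f g : bmeas f -> bmeas g -> bmeas (fun x => f x - g x).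
Proof. by move=> bf bg; apply: bmeasD => //; exact: bmeasN. Qed.

Lemma bmeasX f n : bmeas f -> bmeas (fun x => f x ^+ n).
Proof.
move=> bf; elim: n => [|n ih].
  by under eq_fun do rewrite expr0; exact: bmeas_cst.
by under eq_fun do rewrite exprS; exact: bmeasM.
Qed.

Lemma bmeas_sum (I : Type) (s : seq I) (F : I -> R -> R) :
  (forall i, bmeas (F i)) -> bmeas (fun x => \sum_(i <- s) F i x).
Proof.
move=> bF; elim: s => [|i s ih].
  by under eq_fun do rewrite big_nil; exact: bmeas_cst.
by under eq_fun do rewrite big_cons; exact: bmeasD.
Qed.

Lemma bmeas_norm f : bmeas f -> bmeas (fun x => `|f x|).
Proof.
move=> [mf [B fB]]; split; first exact: measurableT_comp.
by exists B => x; rewrite normr_id.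
Qed.

Lemma bmeas_continuous f B :
  continuous f -> (forall x, `|f x| <= B) -> bmeas f.
Proof. by move=> cf fB; split; [exact: continuous_measurable_fun|exists B]. Qed.

Lemma bmeas_cos r : bmeas (fun x => cos (r * x)).
Proof.
apply: (@bmeas_continuous _ 1); last by move=> x; rewrite ler_norml cos_geN1 cos_le1.
move=> x; apply: continuous_comp; last exact: continuous_cos.
by apply: cvgM; [exact: cvg_cst|exact: cvg_id].
Qed.

Lemma bmeas_sin r : bmeas (fun x => sin (r * x)).
Proof.
apply: (@bmeas_continuous _ 1); last by move=> x; rewrite ler_norml sin_geN1 sin_le1.
move=> x; apply: continuous_comp; last exact: continuous_sin.
by apply: cvgM; [exact: cvg_cst|exact: cvg_id].
Qed.

Lemma bmeas_indic (A : set R) : measurable A -> bmeas (\1_A : R -> R).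
Proof.
move=> mA; split; first exact: measurable_indic.
by exists 1 => x; rewrite indicE; case: (_ \in _); rewrite ?normr1 ?normr0.
Qed.

Lemma continuous_lipschitzR L f :
  (forall x y, `|f x - f y| <= L * `|x - y|) -> continuous f.
Proof.
move=> lf x; apply/cvgrPdist_le => e e0; near=> y.
apply: le_trans (lf _ _) _.
have L0 : 0 < `|L| + 1 by rewrite ltr_wpDl.
apply: (@le_trans _ _ ((`|L| + 1) * `|x - y|)).
  by rewrite ler_wpM2r //; apply: le_trans (ler_norm _) _; rewrite lerDl.
rewrite -ler_pdivlMl //; near: y.
apply: cvgr_dist_le; first exact: cvg_id.
by rewrite mulr_gt0 // invr_gt0.
Unshelve. all: by end_near. Qed.

Lemma bmeas_lipschitz L B f : (forall x y, `|f x - f y| <= L * `|x - y|) ->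
  (forall x, `|f x| <= B) -> bmeas f.
Proof. by move=> /continuous_lipschitzR; exact: bmeas_continuous. Qed.

Lemma bmeas_integrable a b f : bmeas f ->
  mu.-integrable `[a, b]%classic (EFin \o f).
Proof.
move=> [mf [B fB]]; apply: measurable_bounded_integrable => //.
- rewrite /= lebesgue_measure_itv /=; case: ifP => _; exact: ltry.
- exact: measurable_funTS.
exists B; split; first exact: num_real.
by move=> M BM x _; apply: le_trans (fB x) (ltW BM).
Qed.

(** For [b < a] the segment is empty and the value is 0, with no change of sign; hence the
    assumptions [a <= b] in some lemmas. *)
Definition itg a b f : R := \int[mu]_(x in `[a, b]%classic) f x.

Lemma itgD a b f g : bmeas f -> bmeas g ->
  itg a b (fun x => f x + g x) = itg a b f + itg a b g.
Proof. by move=> bf bg; rewrite /itg RintegralD//; exact: bmeas_integrable. Qed.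

Lemma itgB a b f g : bmeas f -> bmeas g ->
  itg a b (fun x => f x - g x) = itg a b f - itg a b g.
Proof. by move=> bf bg; rewrite /itg RintegralB//; exact: bmeas_integrable. Qed.

Lemma itgZ a b r f : bmeas f -> itg a b (fun x => r * f x) = r * itg a b f.
Proof. by move=> bf; rewrite /itg RintegralZl//; exact: bmeas_integrable. Qed.

Lemma eq_itg a b f g : (forall x, a <= x <= b -> f x = g x) ->
  itg a b f = itg a b g.
Proof.
by move=> fg; apply: eq_Rintegral => x; rewrite inE /= in_itv /=; exact: fg.
Qed.

Lemma itg_cst a b r : a <= b -> itg a b (cst r) = r * (b - a).
Proof.
move=> ab; rewrite /itg Rintegral_cst //= lebesgue_measure_itv /=.
case: ifPn => //=; rewrite lte_fin -leNgt => ba.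
by have -> : a = b; [apply/le_anti; rewrite ab ba|rewrite subrr].
Qed.

Lemma itg0 a b : itg a b (cst 0) = 0.
Proof. by rewrite /itg /Rintegral integral0. Qed.

Lemma itg_sum a b (I : Type) (s : seq I) (F : I -> R -> R) :
  (forall i, bmeas (F i)) ->
  itg a b (fun x => \sum_(i <- s) F i x) = \sum_(i <- s) itg a b (F i).
Proof.
move=> bF; elim: s => [|i s ih].
  by rewrite big_nil -[RHS](itg0 a b); apply: eq_itg => x _; rewrite big_nil.
under eq_fun do rewrite big_cons.
by rewrite itgD ?ih ?big_cons //; exact: bmeas_sum.
Qed.

Lemma le_itg a b f g : bmeas f -> bmeas g ->
  (forall x, a <= x <= b -> f x <= g x) -> itg a b f <= itg a b g.
Proof.
by move=> bf bg fg; apply: le_Rintegral => //; exact: bmeas_integrable.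
Qed.

Lemma itg_ge0 a b f : (forall x, a <= x <= b -> 0 <= f x) -> 0 <= itg a b f.
Proof. by move=> f0; apply: Rintegral_ge0 => x /=; rewrite in_itv /=; exact: f0. Qed.

Lemma le_norm_itg a b f : bmeas f -> `|itg a b f| <= itg a b (fun x => `|f x|).
Proof. by move=> bf; apply: le_normr_Rintegral => //; exact: bmeas_integrable. Qed.

Lemma itg_norm_le a b f g : bmeas f -> bmeas g ->
  (forall x, a <= x <= b -> `|f x| <= g x) -> `|itg a b f| <= itg a b g.
Proof.
move=> bf bg fg; apply: le_trans (le_norm_itg _ _ bf) _.
by apply: le_itg => //; exact: bmeas_norm.
Qed.

(** Fubini's theorem on the plane is applied to [G] times the indicators of the two segments; its
    iterated absolute integral is at most [B] times the area of the rectangle. *)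
Lemma itg_fubini a b c d (G : R * R -> R) B :
  measurable_fun setT G -> (forall z, `|G z| <= B) ->
  itg a b (fun x => itg c d (fun y => G (x, y))) =
  itg c d (fun y => itg a b (fun x => G (x, y))).
Proof.
move=> mG GB.
pose H : R * R -> \bar R := fun z =>
  (\1_(`[a, b]%classic : set R) z.1 * \1_(`[c, d]%classic : set R) z.2 * G z)%:E.
have mH : measurable_fun setT H.
  apply/measurable_EFinP; apply: measurable_funM => //; apply: measurable_funM.
    by apply: measurableT_comp => //.
  by apply: measurableT_comp => //.
have bGx x : bmeas (fun y => G (x, y)).
  by split; [exact: measurableT_comp|exists B].
have bGy y : bmeas (fun x => G (x, y)).
  by split; [exact: measurableT_comp|exists B].
have int1 (u v : R) f : bmeas f ->
    (itg u v f)%:E = (\int[mu]_x (\1_(`[u, v]%classic : set R) x * f x)%:E)%E.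
  move=> bf; rewrite /itg /Rintegral fineK.
    rewrite integral_mkcond; apply: eq_integral => x _.
    by rewrite patchE indicE; case: (x \in _); rewrite ?mul1r ?mul0r.
  by apply: integrable_fin_num => //; exact: bmeas_integrable.
have B0 : 0 <= B by apply: le_trans (normr_ge0 _) (GB (0, 0)).
have iH : (mu \x mu)%E.-integrable setT H.
  apply/integrable12ltyP => //.
  apply: (@le_lt_trans _ _
    (\int[mu]_(x in `[a, b]%classic) ((B * fine (mu `[c, d]%classic))%:E))%E).
    rewrite [leRHS]integral_mkcond; apply: ge0_le_integral => //.
    - by move=> x _; apply: integral_ge0.
    - apply: (@measurable_fun_fubini_tonelli_F _ _ _ _ _ mu (fun z => `|H z|%E)) => //.
      by apply: measurableT_comp.
    - exact/(measurable_restrictT _ (measurable_itv _)).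
    move=> x _; rewrite patchE /H /=.
    case: ifPn => xab; last first.
      by rewrite integral0_eq // => y _; rewrite indicE (negbTE xab) !mul0r normr0.
    have fc : (mu `[c, d]%classic < +oo)%E.
      by rewrite /= lebesgue_measure_itv /=; case: ifP => _; rewrite ltry.
    apply: (@le_trans _ _ (\int[mu]_(y in `[c, d]%classic) (B%:E))%E).
      rewrite [leRHS]integral_mkcond; apply: ge0_le_integral => //.
      - apply/measurable_EFinP/measurableT_comp => //.
        apply: measurable_funM; last by case: (bGx x).
        exact: measurable_funM.
      - exact/(measurable_restrictT _ (measurable_itv _)).
      move=> y _; rewrite patchE !indicE xab; case: (_ \in _);
        by rewrite ?mul1r ?mulr1 ?mulr0 ?mul0r ?normr0 ?lee_fin.
    rewrite integral_cst //= EFinM fineK // ge0_fin_numE //.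
  rewrite integral_cst //; apply: lte_mul_pinfty => //.
  - by rewrite lee_fin mulr_ge0 // fine_ge0.
  - by rewrite /= lebesgue_measure_itv /=; case: ifP => _; rewrite ltry.
have h := Fubini iH.
have inner (u v : R) (k : R) f : bmeas f -> (k = 0 \/ k = 1) ->
    (\int[mu]_y (k * (\1_(`[u, v]%classic : set R) y * f y))%:E)%E = (k * itg u v f)%:E.
  move=> bf [->|->]; first by rewrite mul0r integral0_eq // => y _; rewrite mul0r.
  by rewrite mul1r int1 //; apply: eq_integral => y _; rewrite mul1r.
have ind01 (A : set R) x : \1_A x = 0 :> R \/ \1_A x = 1 :> R.
  by rewrite indicE; case: (_ \in _); [right|left].
have outer (u v : R) f :
    itg u v f = fine (\int[mu]_x (\1_(`[u, v]%classic : set R) x * f x)%:E)%E.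
  rewrite /itg /Rintegral integral_mkcond; congr fine; apply: eq_integral => x _.
  by rewrite patchE indicE; case: (x \in _); rewrite ?mul1r ?mul0r.
rewrite !outer; congr fine.
transitivity (\int[mu]_x \int[mu]_y H (x, y))%E.
  apply: eq_integral => x _; rewrite -inner //.
  by apply: eq_integral => y _; rewrite /H /= mulrA.
rewrite h; apply: eq_integral => y _; rewrite -inner //.
by apply: eq_integral => x _; rewrite /H /= mulrCA mulrA.
Qed.
End BoundedMeasurable.

(** * Calculus on segments, and the kernel as an integral of cosines *)

Section IntervalIntegrals.
Context (R : realType).
Implicit Types (f g F : R -> R) (a b c s x y : R).

Lemma itg_FTC a b f F : a <= b -> continuous f ->
  (forall x, is_derive x 1 F (f x)) -> itg a b f = F b - F a.
Proof.
rewrite le_eqVlt => /predU1P[<-|ab] cf dF.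
  by rewrite /itg set_itv1 Rintegral_set1 subrr.
have cF : continuous F.
  move=> x; apply: differentiable_continuous; apply/derivable1_diffP.
  by have [] := dF x.
rewrite /itg /Rintegral (@continuous_FTC2 _ f F) //.
- exact: continuous_subspaceT.
- split.
  + by move=> x _; have [] := dF x.
  + by apply: cvg_at_right_filter; exact: cF.
  + by apply: cvg_at_left_filter; exact: cF.
- by move=> x _; rewrite derive1E; have [] := dF x.
Qed.

Lemma itg_affine h s a b f : 0 < h -> a <= b -> continuous f -> bmeas f ->
  itg (h * a + s) (h * b + s) f = h * itg a b (fun x => f (h * x + s)).
Proof.
move=> h0 ab cf bf.
pose G x := h * x + s.
have cG : continuous G.
  by move=> x; apply: cvgD; [apply: cvgM; [exact: cvg_cst|exact: cvg_id]|exact: cvg_cst].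
have dG x : is_derive x 1 G h.
  by apply: is_derive_eq; rewrite /GRing.scale /= !mulr1 ?addr0.
have dGE : derive1 G = cst h.
  by apply/funext => x; rewrite derive1E; have [] := dG x.
have bfG : bmeas (f \o G).
  have [_ [B fB]] := bf; apply: (@bmeas_continuous _ _ B) => [x|x]; last exact: fB.
  by apply: continuous_comp; [exact: cG|exact: cf].
transitivity (itg a b (fun x => h * (f (G x)))); last by rewrite itgZ.
rewrite /itg /Rintegral -[_ * a + _]/(G a) -[_ * b + _]/(G b).
rewrite (@integration_by_substitution_increasing _ G f) //.
- by congr fine; apply: eq_integral => x _; rewrite dGE /= mulrC.
- by move=> x y _ _ xy; rewrite ltrD2r ltr_pM2l.
- by rewrite dGE => x _; exact: cvg_cst.
- by rewrite dGE; exact: is_cvg_cst.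
- by rewrite dGE; exact: is_cvg_cst.
- split.
  + by move=> x _; have [] := dG x.
  + by apply: cvg_at_right_filter; exact: cG.
  + by apply: cvg_at_left_filter; exact: cG.
- exact: continuous_subspaceT.
Qed.

Lemma itg_opp a b f : a <= b -> continuous f ->
  itg (- b) (- a) f = itg a b (fun x => f (- x)).
Proof.
move=> ab cf; rewrite /itg /Rintegral integration_by_substitution_oppr //.
exact: continuous_subspaceT.
Qed.

Lemma itg_split a b c f : a <= b -> b <= c -> bmeas f ->
  itg a c f = itg a b f + itg b c f.
Proof.
move=> ab bc bf.
have := @Rintegral_itvB R f (BLeft a) (BRight c) b (bmeas_integrable a c bf).
rewrite !bnd_simp => /(_ ab bc) h.
rewrite /itg -(@Rintegral_itv_obnd_cbnd _ b); first by rewrite -h addrC subrK.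
by apply: integrableS (bmeas_integrable b c bf) => //; apply: subset_itvr; rewrite bnd_simp.
Qed.

Lemma itg_even a f : 0 <= a -> continuous f -> bmeas f ->
  (forall x, f (- x) = f x) -> itg (- a) a f = 2 * itg 0 a f.
Proof.
move=> a0 cf bf ev; rewrite (@itg_split _ 0) ?oppr_le0 // -[X in itg _ X f + _]oppr0.
rewrite itg_opp // (@eq_itg _ _ _ (fun x => f (- x)) f) // mulr2n mulrDl !mul1r //.
Qed.

Lemma itg_odd a f : 0 <= a -> continuous f -> bmeas f ->
  (forall x, f (- x) = - f x) -> itg (- a) a f = 0.
Proof.
move=> a0 cf bf od; rewrite (@itg_split _ 0) ?oppr_le0 // -[X in itg _ X f + _]oppr0.
rewrite itg_opp // (@eq_itg _ _ _ (fun x => f (- x)) (fun x => -1 * f x)).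
  by rewrite itgZ // mulN1r addNr.
by move=> x _; rewrite od mulN1r.
Qed.

(** With half-sum [u] and half-difference [v], the difference becomes a product of sines, and
    [|sin v| <= |v|]. *)
Lemma cos_lip x y : `|cos x - cos y| <= `|x - y|.
Proof.
have [u [v [-> ->]]] : exists u v, x = u + v /\ y = u - v.
  by exists ((x + y) / 2), ((x - y) / 2); split; field.
have -> : cos (u + v) - cos (u - v) = - 2 * sin u * sin v.
  by rewrite cosD cosB; ring.
have -> : u + v - (u - v) = 2 * v by ring.
rewrite !normrM normrN -mulrA ler_wpM2l //.
apply: (@le_trans _ _ (1 * `|v|)); last by rewrite mul1r.
by apply: ler_pM => //; [rewrite ler_norml sin_geN1 sin_le1|exact: sin_le_abs].
Qed.

Lemma sin_lip x y : `|sin x - sin y| <= `|x - y|.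
Proof.
rewrite -!cosBpihalf; apply: le_trans (cos_lip _ _) _.
by rewrite opprB addrA subrK.
Qed.

Lemma itg_cos r c : 0 <= c -> r != 0 ->
  itg 0 c (fun t => cos (r * t)) = sin (r * c) / r.
Proof.
move=> c0 r0.
have dF x : is_derive x 1 (fun t => sin (r * t) / r) (cos (r * x)).
  have h : is_derive x 1 (fun t => r * t) r.
    by apply: is_derive_eq; rewrite /GRing.scale /= !mulr1 ?addr0.
  have h2 : is_derive x 1 (fun t => sin (r * t)) (r * cos (r * x)).
    rewrite mulrC; exact: (@is_derive1_comp _ sin (fun t => r * t) x _ _ (is_derive_sin _) h).
  by apply: is_derive_eq; rewrite /GRing.scale /=; field; exact: r0.
rewrite (@itg_FTC _ _ _ _ c0 _ dF) ?mulr0 ?sin0 ?mul0r ?subr0 // => x.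
apply: continuous_comp; last exact: continuous_cos.
by apply: cvgM; [exact: cvg_cst|exact: cvg_id].
Qed.

Lemma kernelE c x y : 0 <= c ->
  sinc_kernel c x y = pi^-1 * itg 0 c (fun t => cos ((y - x) * t)).
Proof.
move=> c0; rewrite /sinc_kernel; case: eqVneq => [->|yx].
  rewrite (@eq_itg _ _ _ _ (cst 1)); last by move=> t _; rewrite subrr mul0r cos0.
  by rewrite itg_cst // mul1r subr0 mulrC.
rewrite itg_cos ?subr_eq0 // [_ * c]mulrC.
by rewrite invfM mulrCA.
Qed.

End IntervalIntegrals.

(** * The sinc kernel operator *)

Section Qoperator.
Context (R : realType).
Implicit Types (f g : R -> R) (c x y t : R).
Let mu : {measure set _ -> \bar R} := @lebesgue_measure R.
Let D : set R := `[-1, 1]%classic.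

Let mD : measurable (D : set (measurableTypeR R)).
Proof. exact: measurable_itv. Qed.

Lemma bmeas_L2I f : bmeas f -> L2I f.
Proof.
move=> bf; rewrite /L2I /= inE; apply/andP; split; rewrite inE /=.
  apply/(measurable_restrictT _ mD).
  by apply: measurable_funTS; case: bf.
rewrite /finite_norm unlock poweR_lty //.
rewrite (_ : (fun x => _) = (EFin \o (fun x => f x ^+ 2)) \_ D); last first.
  apply/funext => x; rewrite /= !patchE; case: ifP => _ /=.
    by rewrite powR_mulrn // real_normK // num_real.
  by rewrite normr0 powR0.
rewrite -integral_mkcond.
exact: (integrable_lty mD (bmeas_integrable (-1) 1 (bmeasX 2 bf))).
Qed.

(** On a segment of finite length, [1 + f ^+ 2] is an integrable majorant of [|f|]. *)
Lemma L2I_integrable f : L2I f -> mu.-integrable D (EFin \o f).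
Proof.
move=> L2f.
have mf : measurable_fun D f.
  apply/(measurable_restrictT _ mD).
  by move: L2f; rewrite /L2I /= inE => /andP[]; rewrite inE.
have if2 : mu.-integrable D (EFin \o (fun y => f y ^+ 2)).
  apply/(integrable_mkcond _ mD).
  have := Lfun2_integrable_sqr L2f.
  apply: eq_integrable => // y _; rewrite /= !patchE; case: ifP => // _.
  by rewrite expr0n.
have i1 : mu.-integrable D (EFin \o cst (1 : R)).
  exact/bmeas_integrable/bmeas_cst.
apply: (le_integrable mD _ _ (integrableD mD i1 if2)).
  exact/measurable_EFinP.
move=> y _; rewrite /= lee_fin [leRHS]ger0_norm ?addr_ge0 ?sqr_ge0 //.
rewrite -(real_normK (num_real (f y))); set t := `|f y|.
have := sqr_ge0 (t - 2^-1); nra.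
Qed.

(** In [kernelE] the integrand is [t]-Lipschitz in [x] with [t <= c]: this gives one factor [c], and
    the length of [[0, c]] gives the other. *)
Lemma kernel_lip c x x' y : 0 <= c ->
  `|sinc_kernel c x y - sinc_kernel c x' y| <= pi^-1 * c ^+ 2 * `|x - x'|.
Proof.
move=> c0; have p0 := pi_gt0 R.
rewrite !kernelE // -mulrBr normrM ger0_norm ?invr_ge0 ?(ltW p0) // -mulrA.
rewrite ler_pM2l ?invr_gt0 //.
rewrite -itgB; [|exact: bmeas_cos..].
apply: (@le_trans _ _ (itg 0 c (cst (c * `|x - x'|)))); last first.
  by rewrite itg_cst // subr0 expr2 mulrAC.
apply: itg_norm_le => [||t /andP[t0 tc]].
- by apply: bmeasB; exact: bmeas_cos.
- exact: bmeas_cst.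
apply: le_trans (cos_lip _ _) _.
rewrite (_ : _ - _ = t * (x' - x)); last by ring.
by rewrite normrM distrC ler_wpM2r // ger0_norm.
Qed.

Definition norm1 f : R := itg (-1) 1 (fun x => `|f x|).

Lemma norm1_ge0 f : 0 <= norm1 f.
Proof. by apply: itg_ge0 => x _. Qed.

Lemma Qop_norm c f x : L2I f -> 0 <= c -> `|Qop c f x| <= c / pi * norm1 f.
Proof.
move=> L2f c0; have p0 := pi_gt0 R.
have iK := kernel_integrable c x L2f.
have iF := integrable_norm (L2I_integrable L2f).
apply: le_trans (le_normr_Rintegral mD iK) _.
rewrite /norm1 /itg -RintegralZl //.
apply: le_Rintegral => //.
- exact: (integrable_norm iK).
- by have := integrableZl mD (c / pi) iF; apply: eq_integrable.
move=> y _; rewrite normrM ler_wpM2r //.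
by apply: le_trans (kernel_bound _ _ _) _; rewrite ger0_norm.
Qed.

(** Together with [Qop_norm] this is the equicontinuity behind compactness: the constants depend on
    [f] only through its L^1 norm. *)
Lemma Qop_lip c f x x' : L2I f -> 0 <= c ->
  `|Qop c f x - Qop c f x'| <= pi^-1 * c ^+ 2 * norm1 f * `|x - x'|.
Proof.
move=> L2f c0; have p0 := pi_gt0 R.
have iK := kernel_integrable c x L2f.
have iK' := kernel_integrable c x' L2f.
have iF := integrable_norm (L2I_integrable L2f).
rewrite /Qop -RintegralB //.
have iKK' := integrableB mD iK iK'.
apply: le_trans (le_normr_Rintegral mD iKK') _.
rewrite mulrAC /norm1 /itg -RintegralZl //.
apply: le_Rintegral => //.
- exact: (integrable_norm iKK').
- by have := integrableZl mD (pi^-1 * c ^+ 2 * `|x - x'|) iF; apply: eq_integrable.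
move=> y _; rewrite -mulrBl normrM ler_wpM2r //.
exact: kernel_lip.
Qed.

(** This smoothing allows an L^2 eigenfunction of a nonzero eigenvalue to be replaced by a bounded
    measurable one. *)
Lemma bmeas_Qop c f : L2I f -> 0 <= c -> bmeas (Qop c f).
Proof.
move=> L2f c0; apply: (@bmeas_lipschitz _ (pi^-1 * c ^+ 2 * norm1 f) (c / pi * norm1 f)).
  by move=> x y; exact: Qop_lip.
by move=> x; exact: Qop_norm.
Qed.

(** [cosT f] and [sinT f] are, up to the sign of the second, the real and imaginary parts of the
    Fourier transform of [f] cut off to [[-1, 1]]. *)
Definition cosT f t : R := itg (-1) 1 (fun y => f y * cos (t * y)).
Definition sinT f t : R := itg (-1) 1 (fun y => f y * sin (t * y)).

(** The transform is Lipschitz in [t], hence measurable: as [|y| <= 1], the phase [t * y] moves at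
    most as much as [t]. *)
Lemma bmeas_trigT (s : R -> R) f : (forall r, bmeas (fun x => s (r * x))) ->
  (forall x y, `|s x - s y| <= `|x - y|) -> (forall x, `|s x| <= 1) ->
  bmeas f -> bmeas (fun t => itg (-1) 1 (fun y => f y * s (t * y))).
Proof.
move=> bs slip s1 bf.
apply: (@bmeas_lipschitz _ (norm1 f) (norm1 f)) => [t t'|t].
  rewrite -itgB; [|by apply: bmeasM..].
  rewrite mulrC -itgZ; last exact: bmeas_norm.
  apply: itg_norm_le.
  - by apply: bmeasB; apply: bmeasM.
  - exact/bmeasZ/bmeas_norm.
  move=> y /andP[y0 y1]; rewrite -mulrBr normrM mulrC ler_wpM2r //.
  apply: le_trans (slip _ _) _; rewrite -mulrBl normrM ler_piMr //.
  by rewrite ler_norml y0.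
apply: itg_norm_le; [exact: bmeasM|exact: bmeas_norm|].
by move=> y _; rewrite normrM ler_piMr.
Qed.

Lemma bmeas_cosT f : bmeas f -> bmeas (cosT f).
Proof.
apply: bmeas_trigT; [exact: bmeas_cos|exact: cos_lip|].
by move=> x; rewrite ler_norml cos_geN1 cos_le1.
Qed.

Lemma bmeas_sinT f : bmeas f -> bmeas (sinT f).
Proof.
apply: bmeas_trigT; [exact: bmeas_sin|exact: sin_lip|].
by move=> x; rewrite ler_norml sin_geN1 sin_le1.
Qed.

Lemma measurable_cosM (u v : R * R -> R) :
  measurable_fun setT u -> measurable_fun setT v ->
  measurable_fun setT (fun z => cos (u z * v z)).
Proof.
move=> meas_u meas_v; apply: measurableT_comp; last exact: measurable_funM.
by apply: continuous_measurable_fun; exact: continuous_cos.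
Qed.

Lemma measurable_sinM (u v : R * R -> R) :
  measurable_fun setT u -> measurable_fun setT v ->
  measurable_fun setT (fun z => sin (u z * v z)).
Proof.
move=> meas_u meas_v; apply: measurableT_comp; last exact: measurable_funM.
by apply: continuous_measurable_fun; exact: continuous_sin.
Qed.

Lemma bmeas_kernel c x : bmeas (sinc_kernel c x).
Proof.
split; first exact: Defs.measurable_kernel.
by exists (`|c| / pi) => y; exact: Defs.kernel_bound.
Qed.

(** After Fubini on [kernelE], the addition formula for [cos (t * y - t * x)] separates [x] from
    [y]. *)
Lemma Qop_trig c f x : bmeas f -> 0 <= c -> Qop c f x =
  pi^-1 * itg 0 c (fun t => cos (t * x) * cosT f t + sin (t * x) * sinT f t).
Proof.
move=> bf c0.
have bk : bmeas (fun y => itg 0 c (fun t => cos ((y - x) * t))).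
  have := bmeasZ pi (bmeas_kernel c x); congr bmeas; apply/funext => y.
  by rewrite kernelE // mulVKf // gt_eqF // pi_gt0.
transitivity (itg (-1) 1 (fun y => pi^-1 * itg 0 c (fun t => f y * cos ((y - x) * t)))).
  apply: eq_itg => y _; rewrite kernelE // itgZ; last exact: bmeas_cos.
  by rewrite -mulrA [_ * f y]mulrC.
rewrite itgZ; last first.
  have := bmeasM bf bk; congr bmeas; apply/funext => y.
  by rewrite itgZ //; exact: bmeas_cos.
congr (_ * _).
have [mf [B fB]] := bf.
rewrite (@itg_fubini _ _ _ _ _ (fun z => f z.1 * cos ((z.1 - x) * z.2)) B); first last.
- move=> z; rewrite normrM -[leRHS]mulr1; apply: ler_pM => //.
  by rewrite ler_norml cos_geN1 cos_le1.
- apply: measurable_funM; first exact: measurableT_comp.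
  by apply: measurable_cosM => //; apply: measurable_funB.
apply: eq_itg => t _ /=.
rewrite /cosT /sinT -!itgZ; last 2 first.
  by apply: bmeasM => //; exact: bmeas_sin.
  by apply: bmeasM => //; exact: bmeas_cos.
rewrite -itgD; last 2 first.
  by apply/bmeasZ/bmeasM => //; exact: bmeas_cos.
  by apply/bmeasZ/bmeasM => //; exact: bmeas_sin.
apply: eq_itg => y _.
by rewrite [(y - x) * t]mulrC mulrBr cosB; ring.
Qed.

Definition ip f g : R := itg (-1) 1 (fun x => f x * g x).

(** The right-hand side is symmetric in [f] and [g], and its integrand is a sum of two squares when
    [f = g]; [Qop_sym] and [Qop_ge0] are read off from it. *)
Lemma ip_Qop c f g : bmeas f -> bmeas g -> 0 <= c -> ip (Qop c f) g =
  pi^-1 * itg 0 c (fun t => cosT f t * cosT g t + sinT f t * sinT g t).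
Proof.
move=> bf bg c0.
have [bC bS] := (bmeas_cosT bf, bmeas_sinT bf).
have bin x : bmeas (fun t => cos (t * x) * cosT f t + sin (t * x) * sinT f t).
  apply: bmeasD; apply: bmeasM => //.
    by under eq_fun do rewrite mulrC; exact: bmeas_cos.
  by under eq_fun do rewrite mulrC; exact: bmeas_sin.
transitivity (itg (-1) 1 (fun x => pi^-1 * itg 0 c (fun t =>
    g x * (cos (t * x) * cosT f t + sin (t * x) * sinT f t)))).
  by apply: eq_itg => x _; rewrite Qop_trig // itgZ // mulrAC mulrA.
rewrite itgZ; last first.
  have := bmeasM bg (bmeasZ pi (bmeas_Qop (bmeas_L2I bf) c0)); congr bmeas.
  apply/funext => x; rewrite Qop_trig // itgZ //.
  by rewrite mulVKf // gt_eqF // pi_gt0.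
congr (_ * _).
have [mC [B1 C1]] := bC.
have [mS [B2 S2]] := bS.
have [mg [B gB]] := bg.
rewrite (@itg_fubini _ _ _ _ _ (fun z =>
    g z.1 * (cos (z.2 * z.1) * cosT f z.2 + sin (z.2 * z.1) * sinT f z.2))
    (B * (B1 + B2))); first last.
- move=> z; rewrite normrM; apply: ler_pM => //.
  apply: le_trans (ler_normD _ _) _; rewrite !normrM.
  apply: lerD; rewrite -[leRHS]mul1r; apply: ler_pM => //.
    by rewrite ler_norml cos_geN1 cos_le1.
  by rewrite ler_norml sin_geN1 sin_le1.
- apply: measurable_funM; first exact: measurableT_comp.
  apply: measurable_funD; apply: measurable_funM; try exact: measurableT_comp.
    exact: measurable_cosM.
  exact: measurable_sinM.
apply: eq_itg => t _ /=.
rewrite [in RHS]/cosT [in RHS]/sinT -/(cosT f t) -/(sinT f t).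
rewrite -!itgZ; last 2 first.
  by apply: bmeasM => //; exact: bmeas_sin.
  by apply: bmeasM => //; exact: bmeas_cos.
rewrite -itgD; last 2 first.
  by apply/bmeasZ/bmeasM => //; exact: bmeas_cos.
  by apply/bmeasZ/bmeasM => //; exact: bmeas_sin.
apply: eq_itg => y _; ring.
Qed.

End Qoperator.

(** * Compactness *)

Section Compactness.
Context (R : realType).

(** [T d] stands for the candidates of quality [d], shrinking as [d] tends to 0. They generate a
    filter on the product of copies of [[-B, B]], which is compact; a neighbourhood of a cluster
    point controls finitely many coordinates. *)
Lemma pointwise_cluster (T : R -> set (R -> R)) (B : R) :
  (forall d : R, 0 < d -> T d !=set0) ->
  (forall d d' : R, 0 < d -> d <= d' -> T d `<=` T d') ->
  (forall d h x, T d h -> `|h x| <= B) ->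
  exists g : R -> R, forall d (s : seq R), 0 < d ->
    exists2 h, T d h & forall x, x \in s -> `|g x - h x| < d.
Proof.
move=> T0 Tmono TB.
pose F := filter_from [set d : R | 0 < d] T.
have FF : ProperFilter F.
  apply: filter_from_proper => [|d d0]; last exact: T0.
  apply: filter_from_filter; first by exists 1 => /=.
  move=> d d' d0 d'0; exists (Num.min d d'); first by rewrite /= lt_min d0.
  have m0 : 0 < Num.min d d' by rewrite lt_min d0.
  by move=> h Th; split; apply: Tmono Th => //; rewrite ge_min lexx // orbT.
have [|g [_ Fg]] := @tychonoff R (fun _ => R) (fun _ => `[- B, B]%classic)
    (fun _ => @segment_compact R (- B) B) F FF.
  exists 1 => //= h Th x /=; rewrite in_itv /=.
  by rewrite -ler_norml; apply: TB Th.
exists g => d s d0.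
have nb : nbhs g [set h : forall _ : R, R | forall x, x \in s -> `|g x - h x| < d].
  elim: s => [|x s ih]; first by apply: filterS filterT => h _ x.
  have nx : nbhs g [set h : forall _ : R, R | `|g x - h x| < d].
    have nbx : nbhs (g x : R) [set r : R | `|g x - r| < d].
      exact: (@nbhsx_ballx R R (g x) d d0).
    exact: (@proj_continuous R (fun _ => R) x g _ nbx).
  apply: filterS2 nx ih => h hx hs y; rewrite in_cons => /predU1P[->//|]; exact: hs.
have FT : F (T d) by exists d.
by have [h [Th hs]] := Fg _ _ FT nb; exists h.
Qed.

(** The common Lipschitz constant passes to the cluster point and upgrades closeness on a finite
    grid to uniform closeness on [[-1, 1]]. *)
Lemma lipschitz_cluster (T : R -> set (R -> R)) (B L : R) :
  (forall d : R, 0 < d -> T d !=set0) ->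
  (forall d d' : R, 0 < d -> d <= d' -> T d `<=` T d') ->
  (forall d h x, T d h -> `|h x| <= B) ->
  (forall d h x y, T d h -> `|h x - h y| <= L * `|x - y|) ->
  exists g : R -> R, [/\ forall x, `|g x| <= B,
    forall x y, `|g x - g y| <= L * `|x - y| &
    forall d, 0 < d -> exists2 h, T d h &
      forall x, -1 <= x <= 1 -> `|h x - g x| <= d].
Proof.
move=> T0 Tmono TB TL.
have [g gP] := pointwise_cluster T0 Tmono TB.
have gL x y : `|g x - g y| <= L * `|x - y|.
  apply/ler_addgt0Pl => e e0.
  have e2 : 0 < e / 2 by rewrite divr_gt0.
  have [h Th hs] := gP _ [:: x; y] e2.
  have hx := hs x (mem_head _ _).
  have hy : `|g y - h y| < e / 2 by apply: hs; rewrite !inE eqxx orbT.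
  have -> : g x - g y = (g x - h x) - (g y - h y) + (h x - h y) by ring.
  apply: le_trans (ler_normD _ _) _; apply: lerD; last exact: TL Th.
  by apply: le_trans (ler_normB _ _) _; rewrite [e]splitr lerD // ltW.
exists g; split => // [x|d d0].
  apply/ler_addgt0Pl => e e0.
  have [h Th hs] := gP _ [:: x] e0.
  have hx := hs x (mem_head _ _).
  have -> : g x = (g x - h x) + h x by ring.
  by apply: le_trans (ler_normD _ _) _; apply: lerD; [exact: ltW|exact: TB Th].
(* Adding 1 keeps the divisor positive. The mesh [eta] makes a move to the nearest grid point on the
   left cost at most [d / 3] for [h] and for [g]; the last third is the error at the grid point. *)
pose L' := `|L| + 1.
have L'0 : 0 < L' by rewrite ltr_wpDl.
pose eta := d / 3 / L'.
have eta0 : 0 < eta by rewrite !divr_gt0.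
(* The index of a grid point below [x] is the integer part of [(x + 1) / eta], at most [N] because
   [x <= 1]. *)
pose N := Num.truncn (2 / eta).
pose s := [seq -1 + eta * i%:R | i <- iota 0 N.+1].
have d3 : 0 < d / 3 by rewrite divr_gt0.
have [h Th hs] := gP _ s d3.
exists h => [|x /andP[x0 x1]].
  by apply: Tmono Th => //; lra.
pose i := Num.truncn ((x + 1) / eta).
have xe0 : 0 <= (x + 1) / eta by apply: divr_ge0; [lra|exact: ltW].
have /andP[i1 i2] := truncn_itv xe0.
pose y := -1 + eta * i%:R.
have ys : y \in s.
  apply/mapP; exists i => //; rewrite mem_iota /= add0n ltnS /i /N.
  apply: le_truncn; rewrite ler_pM2r ?invr_gt0 //; lra.
have xy : `|x - y| <= eta.
  move: i1 i2; rewrite ler_pdivlMr // ltr_pdivrMr // -/i -natr1 mulrDl mul1r.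
  rewrite ler_norml /y [eta * _]mulrC => i1 i2; apply/andP; split; lra.
have Lxy : L * `|x - y| <= d / 3.
  apply: (@le_trans _ _ (L' * eta)); last by rewrite /eta mulrC divfK // gt_eqF.
  apply: (@le_trans _ _ (L' * `|x - y|)).
    by rewrite ler_wpM2r //; apply: le_trans (ler_norm _) _; rewrite lerDl.
  by rewrite ler_pM2l.
have -> : h x - g x = (h x - h y) - (g x - g y) - (g y - h y) by ring.
have := TL _ _ x y Th; have := gL x y; have := hs y ys.
have := ler_normB ((h x - h y) - (g x - g y)) (g y - h y).
have := ler_normB (h x - h y) (g x - g y).
move: Lxy; clear; lra.
Qed.
End Compactness.

(** * Existence of maximizers *)

Section SpectralStep.
Context (R : realType).
Implicit Types (f g h : R -> R) (a b c x y t : R).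

Lemma quad_CS a b d : 0 <= a -> 0 <= d ->
  (forall t, 0 <= a - 2 * t * b + t ^+ 2 * d) -> b ^+ 2 <= a * d.
Proof.
move=> a0; rewrite le_eqVlt => /predU1P[<-|d0] H.
  have [->|b0] := eqVneq b 0; first by rewrite expr0n mulr0.
  (* With [d = 0] the expression is affine in [t]; this [t] gives it the value -1. *)
  have := H ((a + 1) / (2 * b)).
  rewrite mulr0 addr0.
  have -> : 2 * ((a + 1) / (2 * b)) * b = a + 1 by field.
  by rewrite opprD addrA subrr sub0r oppr_ge0 ler10.
have := H (b / d).
have -> : a - 2 * (b / d) * b + (b / d) ^+ 2 * d = a - b ^+ 2 / d.
  by field; rewrite gt_eqF.
by rewrite subr_ge0 ler_pdivrMr.
Qed.

(** Only [e <= 1] is tested, so that errors of size [e ^+ 2] may be bounded by [e] in the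
    applications. *)
Lemma small_eq0 (K z : R) : 0 <= K ->
  (forall e, 0 < e -> e <= 1 -> `|z| <= K * e) -> z = 0.
Proof.
move=> K0 H; apply/eqP; rewrite -normr_le0; apply/ler_addgt0Pl => e e0.
rewrite addr0; have m0 : 0 < Num.min 1 (e / (K + 1)).
  by rewrite lt_min ltr01 divr_gt0 // ltr_wpDl.
apply: le_trans (H _ m0 _) _; first by rewrite ge_min lexx.
apply: (@le_trans _ _ (K * (e / (K + 1)))).
  by rewrite ler_wpM2l // ge_min lexx orbT.
by rewrite mulrCA ler_piMr ?(ltW e0) // ler_pdivrMr ?mul1r ?ltr_wpDl // lerDl.
Qed.

Lemma ipC f g : ip f g = ip g f.
Proof. by apply: eq_itg => x _; rewrite mulrC. Qed.

Lemma eq_ip f f' g : (forall x, -1 <= x <= 1 -> f x = f' x) -> ip f g = ip f' g.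
Proof. by move=> ff'; apply: eq_itg => x xD; rewrite ff'. Qed.

Lemma ip_linl a b f f' g : bmeas f -> bmeas f' -> bmeas g ->
  ip (fun x => a * f x + b * f' x) g = a * ip f g + b * ip f' g.
Proof.
move=> bf bf' bg; rewrite /ip -!itgZ; [|by apply: bmeasM..].
rewrite -itgD; [|by apply: bmeasZ; apply: bmeasM..].
by apply: eq_itg => x _; ring.
Qed.

Lemma ip_linr a b f f' g : bmeas f -> bmeas f' -> bmeas g ->
  ip g (fun x => a * f x + b * f' x) = a * ip g f + b * ip g f'.
Proof. by move=> bf bf' bg; rewrite ipC ip_linl // ![ip _ g]ipC. Qed.

Lemma bmeas_lin a b f g : bmeas f -> bmeas g -> bmeas (fun x => a * f x + b * g x).
Proof. by move=> bf bg; apply: bmeasD; exact: bmeasZ. Qed.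

Lemma ip_ge0 f : 0 <= ip f f.
Proof. by apply: itg_ge0 => x _; rewrite -expr2 sqr_ge0. Qed.

Lemma ip_lin2 a b f g : bmeas f -> bmeas g ->
  ip (fun x => a * f x + b * g x) (fun x => a * f x + b * g x) =
  a ^+ 2 * ip f f + 2 * a * b * ip f g + b ^+ 2 * ip g g.
Proof.
move=> bf bg; have bl := bmeas_lin a b bf bg.
by rewrite ip_linl // !ip_linr // [ip g f]ipC; ring.
Qed.

Lemma ip_CS f g : bmeas f -> bmeas g -> ip f g ^+ 2 <= ip f f * ip g g.
Proof.
move=> bf bg; apply: quad_CS; rewrite ?ip_ge0 // => t.
have := ip_ge0 (fun x => 1 * f x + (- t) * g x).
rewrite ip_lin2 //; congr (0 <= _); ring.
Qed.

(** Cauchy-Schwarz against the constant 1, whose squared norm on [[-1, 1]] is 2. *)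
Lemma norm1_sqr f : bmeas f -> norm1 f ^+ 2 <= 2 * ip f f.
Proof.
move=> bf; have := ip_CS (bmeas_norm bf) (bmeas_cst 1).
have -> : ip (fun x => `|f x|) (cst 1) = norm1 f.
  by apply: eq_itg => x _; rewrite mulr1.
have -> : ip (fun x => `|f x|) (fun x => `|f x|) = ip f f.
  by apply: eq_itg => x _; rewrite -normrM ger0_norm // -expr2 sqr_ge0.
have -> : ip (cst 1) (cst 1) = 2 :> R.
  rewrite -[RHS](_ : 1 * (1 - -1) = 2); last by ring.
  by rewrite -itg_cst; [apply: eq_itg => x _; rewrite mulr1|lra].
by rewrite mulrC.
Qed.

Lemma norm1_le d f : bmeas f -> (forall x, -1 <= x <= 1 -> `|f x| <= d) ->
  norm1 f <= 2 * d.
Proof.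
move=> bf fd; have -> : 2 * d = d * (1 - -1) by ring.
rewrite -itg_cst; last by lra.
by apply: le_itg => //; [exact: bmeas_norm|exact: bmeas_cst].
Qed.

Lemma ip_norm1 d f g : bmeas f -> bmeas g ->
  (forall x, -1 <= x <= 1 -> `|f x| <= d) -> `|ip f g| <= d * norm1 g.
Proof.
move=> bf bg fd; rewrite /norm1 -itgZ; last exact: bmeas_norm.
apply: itg_norm_le; [exact: bmeasM|exact/bmeasZ/bmeas_norm|].
by move=> x xD; rewrite normrM ler_wpM2r // fd.
Qed.

Section Step.
Variables (c : R).
Hypothesis c0 : 0 <= c.
Let Q := Qop c.
Let p0 : 0 < pi :> R := pi_gt0 R.
Let cp0 : 0 <= c / pi.
Proof. by rewrite divr_ge0 // ltW. Qed.

Let bQ f : bmeas f -> bmeas (Q f).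
Proof. by move=> /bmeas_L2I L2f; exact: bmeas_Qop. Qed.

Lemma Qop_lin a b f g x : bmeas f -> bmeas g ->
  Q (fun x => a * f x + b * g x) x = a * Q f x + b * Q g x.
Proof.
move=> bf bg; have bk := bmeas_kernel c x.
rewrite /Q /Qop -!/(itg (-1) 1 _) -!itgZ; [|by apply: bmeasM..].
rewrite -itgD; [|by apply: bmeasZ; apply: bmeasM..].
by apply: eq_itg => y _; ring.
Qed.

Lemma Qop_sym f g : bmeas f -> bmeas g -> ip (Q f) g = ip f (Q g).
Proof.
move=> bf bg; rewrite [RHS]ipC (ip_Qop bf bg c0) (ip_Qop bg bf c0).
apply: (congr1 (fun z => pi^-1 * z)); apply: eq_itg => t _.
by rewrite [cosT g t * _]mulrC [sinT g t * _]mulrC.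
Qed.

Lemma Qop_ge0 f : bmeas f -> 0 <= ip (Q f) f.
Proof.
move=> bf; rewrite ip_Qop //; apply: mulr_ge0; first by rewrite invr_ge0 ltW.
by apply: itg_ge0 => t _; rewrite -!expr2 addr_ge0 ?sqr_ge0.
Qed.

(** A crude bound, whose purpose is to make the suprema of Rayleigh quotients and of eigenvalues
    finite. *)
Lemma Qop_form_le f : bmeas f -> ip (Q f) f <= 2 * (c / pi) * ip f f.
Proof.
move=> bf; apply: le_trans (ler_norm _) _.
apply: (@le_trans _ _ (c / pi * norm1 f * norm1 f)).
  by apply: ip_norm1 => //; [exact: bQ|move=> x _; exact/Qop_norm/c0/bmeas_L2I].
rewrite -mulrA -expr2 [2 * _]mulrC -[leRHS]mulrA ler_wpM2l //.
exact: norm1_sqr.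
Qed.

(** The hypotheses on [S] are those of an invariant subspace closed under uniform limits on
    [[-1, 1]]; [f0] ensures that the supremum [M] is at least [k]. The eigenvalue equation is
    obtained at every point of the segment. *)
Lemma spectral_step (S : set (R -> R)) (k : R) f0 :
  (forall f, S f -> bmeas f) ->
  (forall a b f g, S f -> S g -> S (fun x => a * f x + b * g x)) ->
  (forall f, S f -> S (Q f)) ->
  (forall g, bmeas g -> (forall d, 0 < d -> exists2 f, S f &
     forall x, -1 <= x <= 1 -> `|f x - g x| <= d) -> S g) ->
  0 < k -> S f0 -> 0 < ip f0 f0 -> k * ip f0 f0 <= ip (Q f0) f0 ->
  exists M g, [/\ k <= M, S g, 0 < ip g g &
    forall x, -1 <= x <= 1 -> Q g x = M * g x].
Proof.
move=> Sb Slin SQ Slim k0 Sf0 f00 kf0.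
pose V := [set ip (Q f) f | f in [set f | S f /\ ip f f = 1]].
have unit f : S f -> 0 < ip f f -> V (ip (Q f) f / ip f f).
  move=> Sf ff0; pose r := (Num.sqrt (ip f f))^-1.
  have r2 : r ^+ 2 = (ip f f)^-1 by rewrite exprVn sqr_sqrtr // ltW.
  have bf := Sb _ Sf.
  (* The term [0 * f x] casts the rescaled function as a two-term combination, the form in which
     linearity of [S] is assumed. *)
  have E1 : ip (fun x => r * f x + 0 * f x) (fun x => r * f x + 0 * f x) = 1.
    by rewrite ip_lin2 // mulr0 !mul0r expr0n mul0r !addr0 r2 mulVf // gt_eqF.
  exists (fun x => r * f x + 0 * f x); first by split => //; exact: Slin.
  have -> : Q (fun x => r * f x + 0 * f x) = (fun x => r * Q f x + 0 * Q f x).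
    by apply/funext => x; rewrite Qop_lin.
  rewrite ip_linl ?ip_linr //; try exact: bQ; last exact: bmeas_lin.
  by rewrite !mul0r !addr0 mulrA -expr2 r2 mulrC.
have Vsup : has_sup V.
  split; first by exists (ip (Q f0) f0 / ip f0 f0); exact: unit.
  exists (2 * (c / pi)) => _ [f [Sf f1] <-].
  by apply: le_trans (Qop_form_le (Sb _ Sf)) _; rewrite f1 mulr1.
pose M := sup V.
have kM : k <= M.
  apply: (@le_trans _ _ (ip (Q f0) f0 / ip f0 f0)); first by rewrite ler_pdivlMr.
  by apply: ub_le_sup; [exact: Vsup.2|exact: unit].
have M0 : 0 < M := lt_le_trans k0 kM.
have QM f : S f -> ip (Q f) f <= M * ip f f.
  move=> Sf; have bf := Sb _ Sf.
  have := ip_ge0 f; rewrite le_eqVlt => /predU1P[f0'|f0'].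
    by have := Qop_form_le bf; rewrite -f0' !mulr0.
  by rewrite -ler_pdivrMr //; apply: ub_le_sup; [exact: Vsup.2|exact: unit].
  (* Positivity of the form at [f - Q f / M]. *)
  have QQM f : S f -> ip (Q f) (Q f) <= M * ip (Q f) f.
  move=> Sf; have bf := Sb _ Sf; have bg := bQ bf; have bQg := bQ bg.
  pose t := M^-1.
  have := Qop_ge0 (bmeas_lin 1 (- t) bf bg).
  have -> : Q (fun x => 1 * f x + (- t) * Q f x) = (fun x => 1 * Q f x + (- t) * Q (Q f) x).
    by apply/funext => x; rewrite Qop_lin.
  rewrite ip_linl ?ip_linr //; last exact: bmeas_lin.
  rewrite (Qop_sym bg bf).
  (* The bound [QM] at [Q f] gives [w <= M * u]; inserted in the positivity inequality
     [0 <= v - 2 * t * u + t ^+ 2 * w], it leaves [t * u <= v]. *)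
  have := QM _ (SQ _ Sf).
  set u := ip (Q f) (Q f); set v := ip (Q f) f; set w := ip (Q (Q f)) (Q f).
  move=> wu H; rewrite mulrC -ler_pdivrMr //.
  have h1 : t * w <= u by rewrite /t mulrC ler_pdivrMr // mulrC.
  have h2 : t * (t * w) <= t * u by rewrite ler_pM2l // invr_gt0.
  rewrite [u / M]mulrC -/t; move: H h2; nra.
have res f : S f -> ip f f = 1 ->
    ip (fun x => 1 * Q f x + (- M) * f x) (fun x => 1 * Q f x + (- M) * f x) <=
    M * (M - ip (Q f) f).
  move=> Sf f1; have bf := Sb _ Sf; have bg := bQ bf.
  rewrite ip_lin2 // f1; have := QQM f Sf; lra.
(* The near-maximizers need not cluster uniformly, but their images under [Q] are bounded and
   equi-Lipschitz. *)
pose T d := [set h | exists f, [/\ S f, ip f f = 1, M - d < ip (Q f) f & h = Q f]].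
have n1 f : S f -> ip f f = 1 -> norm1 f <= 2.
  move=> Sf f1; have := norm1_sqr (Sb _ Sf); rewrite f1 mulr1; have := norm1_ge0 f.
  nra.
have [|||| g [gB gL gT]] := @lipschitz_cluster R T (c / pi * 2) (pi^-1 * c ^+ 2 * 2).
- move=> d d0; have [_ [f [Sf f1] <-] fM] := sup_adherent d0 Vsup.
  by exists (Q f), f; split.
- move=> d d' d0 dd' _ [f [Sf f1 fM ->]]; exists f; split => //.
  by apply: le_lt_trans fM; rewrite lerB.
- move=> d _ x [f [Sf f1 fM ->]].
  apply: le_trans (Qop_norm _ (bmeas_L2I (Sb _ Sf)) c0) _.
  by rewrite ler_wpM2l // n1.
- move=> d _ x y [f [Sf f1 fM ->]].
  apply: le_trans (Qop_lip _ _ (bmeas_L2I (Sb _ Sf)) c0) _.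
  rewrite ler_wpM2r // ler_wpM2l ?n1 // mulr_ge0 ?sqr_ge0 // invr_ge0.
  exact: ltW.
have bg : bmeas g by exact: bmeas_lipschitz gL gB.
have Sg : S g.
  apply: Slim => // d d0; have [_ [f [Sf f1 fM ->]] Qfg] := gT d d0.
  by exists (Q f) => //; exact: SQ.
exists M, g; split => // [|x xD].
  (* If [g] had norm 0, [Q f] within [M / 4] of [g] would have squared norm at most [M ^+ 2 / 8],
     whereas Cauchy-Schwarz with the unit vector [f] gives at least [(3 / 4 * M) ^+ 2]. *)
  rewrite lt_neqAle ip_ge0 andbT eq_sym; apply/negP => /eqP g0.
  have d0 : 0 < M / 4 by rewrite divr_gt0.
  have [_ [f [Sf f1 fM ->]] Qfg] := gT _ d0.
  have bf := Sb _ Sf; have bQf := bQ bf.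
  have := ip_CS bQf bg; rewrite g0 mulr0 => Qfg0.
  have {Qfg0} Qfg0 : ip (Q f) g = 0.
    by apply/eqP; rewrite -sqrf_eq0 eq_le Qfg0 sqr_ge0.
  have := ip_lin2 1 (-1) bQf bg; rewrite Qfg0 g0 expr1n mul1r !mulr0 !addr0 => e.
  have := ip_CS bQf bf; rewrite f1 mulr1 -e.
  have bd := bmeas_lin 1 (-1) bQf bg.
  have dd x : -1 <= x <= 1 -> `|1 * Q f x + -1 * g x| <= M / 4.
    by move=> xD; rewrite mul1r mulN1r Qfg.
  have := ip_norm1 bd bd dd; have := norm1_le bd dd.
  rewrite ger0_norm ?ip_ge0 //; set u := ip _ _; set w := ip (Q f) f in fM *; set v := norm1 _.
  move=> h1 h2 h3.
  have h4 : M / 4 * v <= M / 4 * (2 * (M / 4)) by rewrite ler_pM2l.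
  have h5 : u <= M ^+ 2 / 8 by apply: le_trans h2 (le_trans h4 _); lra.
  have h6 : (3 / 4 * M) ^+ 2 <= w ^+ 2.
    have h7 : 3 / 4 * M <= w by lra.
    have h8 : 0 <= 3 / 4 * M by lra.
    by rewrite ler_pXn2r ?nnegrE // (le_trans h8).
  have : 0 < M ^+ 2 by rewrite exprn_gt0.
  move: h3 h5 h6; lra.
(* The three terms bound, per unit of [e], the parts [Q (g - Q f)], [Q (Q f - M f)] and
   [M (Q f - g)] of [Q g - M g]. *)
pose K := c / pi * 2 + c / pi * (2 * M + 1) + M.
apply/eqP; rewrite -subr_eq0; apply/eqP.
apply: (@small_eq0 K) => [|e e0 e1].
  by rewrite /K; have := cp0; have := mulr_ge0 cp0 (ltW M0); have := M0; nra.
(* Quality [e ^+ 2] is required because [res] controls the square of the residual; its norm is then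
   of order [e]. *)
have d0 : 0 < e ^+ 2 by rewrite exprn_gt0.
have ee : e ^+ 2 <= e by rewrite expr2 ler_piMr // ltW.
have [_ [f [Sf f1 fM ->]] Qfg] := gT _ d0.
have bf := Sb _ Sf; have bQf := bQ bf.
have br := bmeas_lin 1 (- M) bQf bf.
have bd := bmeas_lin 1 (-1) bg bQf.
have h1 := Qop_norm x (bmeas_L2I bd) c0.
have h2 := Qop_norm x (bmeas_L2I br) c0.
move: h1 h2; rewrite -/Q !Qop_lin // => h1 h2.
have -> : Q g x - M * g x = (1 * Q g x + -1 * Q (Q f) x) +
   (1 * Q (Q f) x + - M * Q f x) + M * (Q f x - g x) by ring.
have n1d : norm1 (fun x => 1 * g x + -1 * Q f x) <= 2 * e.
  apply: norm1_le => // y yD; apply: le_trans ee.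
  by rewrite mul1r mulN1r distrC Qfg.
(* The square of the left side is at most [2 * M * e ^+ 2], and [2 * M <= (2 * M + 1) ^+ 2] avoids a
   square root. *)
have n1r : norm1 (fun x => 1 * Q f x + - M * f x) <= (2 * M + 1) * e.
  have := norm1_sqr br; have := res _ Sf f1; have := norm1_ge0 (fun x => 1 * Q f x + - M * f x).
  set u := norm1 _; set v := ip _ _; set w := ip _ _ in fM * => u0 hv hu.
  rewrite -(@ler_pXn2r _ 2) ?nnegrE //; last first.
    by rewrite mulr_ge0 ?(ltW e0) // addr_ge0 // mulr_ge0 // ltW.
  apply: (le_trans hu); rewrite exprMn.
  apply: (@le_trans _ _ (2 * (M * e ^+ 2))).
    rewrite ler_pM2l //; apply: le_trans hv _; rewrite ler_pM2l //.
    by rewrite lerBlDr addrC -lerBlDr ltW.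
  rewrite mulrA ler_pM2r //; move: M0; nra.
have -> : K * e = c / pi * (2 * e) + c / pi * ((2 * M + 1) * e) + M * e.
  by rewrite /K; ring.
apply: le_trans (ler_normD _ _) _; apply: lerD.
  apply: le_trans (ler_normD _ _) _; apply: lerD.
    by apply: le_trans h1 _; rewrite ler_wpM2l.
  by apply: le_trans h2 _; rewrite ler_wpM2l.
rewrite normrM ger0_norm ?(ltW M0) // ler_pM2l //.
exact: le_trans (Qfg _ xD) ee.
Qed.

End Step.
End SpectralStep.

(** * The max-min principle *)

(** Supplies a nonzero combination of the trial functions orthogonal to fewer eigenfunctions than
    there are trial functions. *)
Lemma left_kernel_vector (F : fieldType) (m n : nat) (A : 'M[F]_(n, m)) :
  (m < n)%N -> exists2 v : 'rV[F]_n, v != 0 & v *m A = 0.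
Proof.
move=> mn; have : kermx A != 0.
  rewrite kermx_eq0 -row_leq_rank -ltnNge.
  exact: leq_ltn_trans (rank_leq_col A) mn.
by case/rowV0Pn => v /sub_kermxP vA v0; exists v.
Qed.

Section EigenvalueBounds.
Context (R : realType).
Implicit Types (f g h : R -> R) (a b x y t : R).
Variables (c : R).
Hypothesis c0 : 0 <= c.
Let mu : {measure set _ -> \bar R} := @lebesgue_measure R.
Let D : set R := `[-1, 1]%classic.
Let mD : measurable (D : set (measurableTypeR R)).
Proof. exact: measurable_itv. Qed.

Lemma ip_sum (I : Type) (s : seq I) (F : I -> R -> R) g :
  (forall i, bmeas (F i)) -> bmeas g ->
  ip (fun x => \sum_(i <- s) F i x) g = \sum_(i <- s) ip (F i) g.
Proof.
move=> bF bg; rewrite -itg_sum; last by move=> i; exact: bmeasM.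
by apply: eq_itg => x _; rewrite mulr_suml.
Qed.

(** Induction on [m], with [spectral_step] on the orthogonal complement of the first [m]
    eigenfunctions, invariant because [Q] is symmetric. The [l i] come unordered and may repeat;
    that each is at least [k] is what matters. *)
Lemma eigen_family (n : nat) (k : R) (phi : 'I_n.+1 -> R -> R) :
  0 < k -> (forall i, bmeas (phi i)) ->
  (forall v : 'rV[R]_n.+1, v != 0 ->
    let f x := \sum_i v 0 i * phi i x in
    0 < ip f f /\ k * ip f f <= ip (Qop c f) f) ->
  forall m, (m <= n.+1)%N ->
  exists (e : nat -> R -> R) (l : nat -> R),
    (forall i, (i < m)%N -> [/\ bmeas (e i), 0 < ip (e i) (e i), k <= l i &
      forall x, -1 <= x <= 1 -> Qop c (e i) x = l i * e i x]) /\
    (forall i j, (i < m)%N -> (j < m)%N -> i != j -> ip (e i) (e j) = 0).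
Proof.
move=> k0 bphi phik; elim=> [_|m ih mn].
  by exists (fun _ => cst 0), (fun _ => 0).
have [e [l [eP eO]]] := ih (ltnW mn).
pose A := \matrix_(i < n.+1, j < m) ip (phi i) (e j).
have [v v0 vA] := left_kernel_vector A mn.
(* Since [v *m A = 0], this combination is orthogonal to every [e j] found so far. *)
pose f0 x := \sum_i v 0 i * phi i x.
have [f00 kf0] := phik v v0.
have bv i : bmeas (fun x => v 0 i * phi i x) by exact: bmeasZ.
pose S : set (R -> R) := [set f | bmeas f /\ forall i, (i < m)%N -> ip f (e i) = 0].
have [||||||||M [g [kM [bg gO] g0 Qg]]] := @spectral_step R c c0 S k f0.
- by move=> f [].
- move=> a b f g [bf fO] [bg gO]; split; first exact: bmeas_lin.
  move=> i im; have [bei _ _ _] := eP i im.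
  by rewrite ip_linl // fO // gO // !mulr0 addr0.
- move=> f [bf fO]; split; first by apply: bmeas_Qop => //; exact: bmeas_L2I.
  move=> i im; have [bei _ _ Qe] := eP i im.
  rewrite Qop_sym // ipC (eq_ip (f' := fun x => l i * e i x + 0 * e i x)).
    by rewrite ip_linl // ipC fO // mulr0 mul0r addr0.
  by move=> x xD; rewrite Qe // mul0r addr0.
- move=> g bg gS; split => // i im; have [bei _ _ _] := eP i im.
  apply: (@small_eq0 _ (norm1 (e i))); first exact: norm1_ge0.
  move=> d d0 _; have [f [bf fO] fg] := gS d d0.
  have -> : ip g (e i) = ip (fun x => 1 * g x + -1 * f x) (e i).
    by rewrite ip_linl // fO // mulr0 addr0 mul1r.
  rewrite mulrC; apply: ip_norm1 => //; first exact: bmeas_lin.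
  by move=> x xD; rewrite mul1r mulN1r distrC fg.
- exact: k0.
- split; first exact: bmeas_sum.
  move=> i im; have [bei _ _ _] := eP i im.
  rewrite ip_sum //.
  have := congr1 (fun B : 'rV_m => B 0 (Ordinal im)) vA; rewrite !mxE => vAi.
  rewrite -[RHS]vAi; apply: eq_bigr => j _; rewrite mxE.
  by rewrite /ip -itgZ; [apply: eq_itg => x _; rewrite mulrA|exact: bmeasM].
- exact: f00.
- exact: kf0.
exists (fun i => if i == m then g else e i), (fun i => if i == m then M else l i).
split => [i|i j].
  rewrite ltnS leq_eqVlt; case: (eqVneq i m) => [-> _|_ /= im]; last exact: eP.
  by split.
rewrite !ltnS [(i <= m)%N]leq_eqVlt [(j <= m)%N]leq_eqVlt; case: (eqVneq i m) => [->|_] /=.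
  case: (eqVneq j m) => [->|_] /= _ jm; first by [].
  by move=> _; exact: gO.
case: (eqVneq j m) => [_|_] /= im jm ij; last exact: eO.
by rewrite ipC; exact: gO.
Qed.

Lemma bmeas_measD f : bmeas f -> measurable_fun D (EFin \o f).
Proof. by move=> [mf _]; apply/measurable_EFinP; exact: measurable_funTS. Qed.

Lemma eqI_ip0 f : bmeas f -> eqI f (cst 0) -> ip f f = 0.
Proof.
move=> bf f0; rewrite /ip /itg /Rintegral (ae_eq_integral (cst 0%E)) ?integral0 //.
  by apply: bmeas_measD; exact: bmeasM.
by apply: filterS f0 => x h /h /= ->; rewrite mul0r.
Qed.

Lemma ip0_eqI f : bmeas f -> ip f f = 0 -> eqI f (cst 0).
Proof.
move=> bf f0; have bff := bmeasM bf bf.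
have : (\int[mu]_(x in D) `|(f x * f x)%:E|)%E = 0%E.
  transitivity (ip f f)%:E; last by rewrite f0.
  rewrite -(fineK (integrable_fin_num mD (integrable_norm (bmeas_integrable (-1) 1 bff)))).
  rewrite /ip /itg /Rintegral; congr (fine _)%:E.
  by apply: eq_integral => x _; rewrite /= ger0_norm // -expr2 sqr_ge0.
move/(ae_eq_integral_abs _ mD (bmeas_measD bff)).
by apply: filterS => x h /h /= [] /eqP; rewrite -expr2 sqrf_eq0 => /eqP.
Qed.

Lemma Qop_ae f g x : L2I f -> L2I g -> eqI f g -> Qop c f x = Qop c g x.
Proof.
move=> L2f L2g fg; rewrite /Qop /Rintegral.
have mf := measurable_int _ (kernel_integrable c x L2f).
have mg := measurable_int _ (kernel_integrable c x L2g).
congr fine; apply: ae_eq_integral => //.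
by apply: filterS fg => y h /h /= ->.
Qed.

(** For [m != 0] the eigenfunction is replaced by [m^-1 * Q f0], equal to it almost everywhere,
    bounded, and satisfying the equation at every point. Then [m] is its Rayleigh quotient. *)
Lemma eigenvalue_bounds m : Qeigenvalue c m -> 0 <= m <= 2 * (c / pi).
Proof.
move=> [f0 [L2f0 ef0] nf0]; have p0 := pi_gt0 R.
have [->|m0] := eqVneq m 0.
  by rewrite lexx mulr_ge0 // divr_ge0 // ltW.
pose f x := m^-1 * Qop c f0 x.
have bf : bmeas f by apply: bmeasZ; exact: bmeas_Qop.
have ff0 : eqI f f0.
  by apply: filterS ef0 => x h /h /= e; rewrite /f e mulKf.
have Qf x : Qop c f x = m * f x.
  by rewrite (Qop_ae x (bmeas_L2I bf) L2f0 ff0) /f mulVKf.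
have ff : 0 < ip f f.
  rewrite lt_neqAle ip_ge0 andbT eq_sym; apply/negP => /eqP /(ip0_eqI bf) fz.
  apply: nf0; apply: filterS2 fz ff0 => x h1 h2 Dx.
  by rewrite -h2 // h1.
have e : ip (Qop c f) f = m * ip f f.
  rewrite /ip -itgZ; last exact: bmeasM.
  by apply: eq_itg => x _; rewrite Qf mulrA.
have := Qop_ge0 c0 bf; have := Qop_form_le c0 bf.
by rewrite e ler_pM2r // pmulr_lge0 // => -> ->.
Qed.

Lemma lambda_ge0 n : 0 <= lambda c n.
Proof.
rewrite /lambda; set S := [set m | _].
(* The supremum of the empty set is 0 by convention. *)
have [->|/set0P[m Sm]] := eqVneq S set0; first by rewrite sup0.
have [mc _] := Sm; have /andP[m0 _] := eigenvalue_bounds mc.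
apply: le_trans m0 _; apply: ub_le_sup => //.
by exists (2 * (c / pi)) => m' [/eigenvalue_bounds /andP[]].
Qed.

(** The least eigenvalue of the family is a member of the set whose supremum is [lambda c n],
    witnessed by the whole orthogonal family. *)
Lemma lambda_minmax (n : nat) (k : R) (phi : 'I_n.+1 -> R -> R) :
  0 < k -> (forall i, bmeas (phi i)) ->
  (forall v : 'rV[R]_n.+1, v != 0 ->
    let f x := \sum_i v 0 i * phi i x in
    0 < ip f f /\ k * ip f f <= ip (Qop c f) f) ->
  k <= lambda c n.
Proof.
move=> k0 bphi phik; have [e [l [eP eO]]] := eigen_family k0 bphi phik (leqnn _).
have eE (i : 'I_n.+1) : in_eigenspace c (l i) (e i).
  have [bei _ _ Qe] := eP i (ltn_ord i).
  split; first exact: bmeas_L2I.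
  by apply: aeW => x /=; rewrite in_itv /=; exact: Qe.
have eN0 (i : 'I_n.+1) : ~ eqI (e i) (cst 0).
  have [bei ei0 _ _] := eP i (ltn_ord i).
  by move=> /(eqI_ip0 bei) ei0'; rewrite ei0' ltxx in ei0.
have [i _ imin] : extremum_spec <=%O xpredT (fun i : 'I_n.+1 => l i) [arg min_(i < ord0) l i]%O.
  exact: arg_minP.
have [_ _ kl _] := eP i (ltn_ord i).
apply: le_trans kl _; apply: ub_le_sup.
  by exists (2 * (c / pi)) => m' [/eigenvalue_bounds /andP[]].
split; first by exists (e i).
exists (fun i : 'I_n.+1 => e i); last by move=> j; exists (l j); [exact: imin|exact: eE].
move=> a a0 j.
have be (i' : 'I_n.+1) : bmeas (e i') by have [] := eP i' (ltn_ord i').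
have bs : bmeas (fun x => \sum_(i < n.+1) a i * e i x).
  by apply: bmeas_sum => i'; exact: bmeasZ.
(* Pairing the vanishing combination with [e j] isolates the coefficient [a j]. *)
have s0 : ip (fun x => \sum_(i < n.+1) a i * e i x) (e j) = 0.
  have := ip_CS bs (be j); rewrite (eqI_ip0 bs a0) mul0r => h.
  by apply/eqP; rewrite -sqrf_eq0 eq_le h sqr_ge0.
move: s0; rewrite ip_sum //; last by move=> i'; exact: bmeasZ.
have ipZ i' : ip (fun x => a i' * e i' x) (e j) = a i' * ip (e i') (e j).
  by rewrite /ip -itgZ; [apply: eq_itg => x _; rewrite mulrA|exact: bmeasM].
rewrite (bigD1 j) //= ipZ big1 => [|i' i'j]; last first.
  by rewrite ipZ eO ?mulr0.
have [_ ej _ _] := eP j (ltn_ord j).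
by rewrite addr0 => /eqP; rewrite mulf_eq0 (gt_eqF ej) orbF => /eqP.
Qed.

End EigenvalueBounds.

(** * Trigonometric polynomials *)

Section TrigPolynomials.
Context (R : realType).
Implicit Types (p : {poly R}) (t : R).
Local Notation C := (R[i]).
Local Open Scope complex_scope.

Lemma expr_cis t k :
  (cos t +i* sin t) ^+ k = cos (t * k%:R) +i* sin (t * k%:R) :> C.
Proof.
elim: k => [|k ih]; first by rewrite expr0 mulr0 cos0 sin0.
rewrite exprS ih -natr1 mulrDr mulr1 [_ + t]addrC cosD sinD.
by apply/eqP; rewrite eq_complex /= eqxx /= addrC.
Qed.

(** This is [|p (e^{it})|^2] for real coefficients, as real part squared plus imaginary part
    squared. *)
Definition sqtrig (n : nat) p t : R :=
  (\sum_(k < n) p`_k * cos (t * k%:R)) ^+ 2 +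
  (\sum_(k < n) p`_k * sin (t * k%:R)) ^+ 2.

Lemma sqnorm_circle_real n p t : (size p <= n)%N ->
  sqnorm_circle (map_poly (real_complex R) p) t = sqtrig n p t.
Proof.
move=> pn; rewrite /sqnorm_circle.
have -> : (map_poly (real_complex R) p).[cos t +i* sin t] =
    (\sum_(k < n) p`_k * cos (t * k%:R)) +i* (\sum_(k < n) p`_k * sin (t * k%:R)).
  rewrite (@horner_coef_wide _ n); last by rewrite size_map_poly.
  transitivity (\sum_(k < n) ((p`_k * cos (t * k%:R)) +i* (p`_k * sin (t * k%:R)) : C)).
    apply: eq_bigr => k _; rewrite coef_map expr_cis.
    by apply/eqP; rewrite eq_complex /= !mul0r subr0 addr0 !eqxx.
  elim/big_rec3: _ => // k x y z _ ->.
  by apply/eqP; rewrite eq_complex /= !eqxx.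
by rewrite /= sqr_sqrtr // addr_ge0 ?sqr_ge0.
Qed.

Lemma bmeas_trigsum (s : R -> R) n p : (forall r, bmeas (fun x => s (r * x))) ->
  bmeas (fun t => \sum_(k < n) p`_k * s (t * k%:R)).
Proof.
move=> bs; apply: bmeas_sum => k; apply: bmeasZ.
by under eq_fun do rewrite mulrC; exact: bs.
Qed.

Lemma continuous_trigsum (s : R -> R) n p : continuous s ->
  continuous (fun t => \sum_(k < n) p`_k * s (t * k%:R)).
Proof.
move=> cs; elim: n => [|n ih].
  by under eq_fun do rewrite big_ord0; move=> x; exact: cvg_cst.
under eq_fun do rewrite big_ord_recr /=.
move=> x; apply: cvgD; first exact: ih.
apply: cvgM; first exact: cvg_cst.
apply: continuous_comp; last exact: cs.
by apply: cvgM; [exact: cvg_id|exact: cvg_cst].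
Qed.

Lemma bmeas_sqtrig n p : bmeas (sqtrig n p).
Proof.
by apply: bmeasD; apply: bmeasX; apply: bmeas_trigsum; [exact: bmeas_cos|exact: bmeas_sin].
Qed.

Lemma continuous_sqtrig n p : continuous (sqtrig n p).
Proof.
have cc := @continuous_trigsum cos n p (@continuous_cos R).
have cs := @continuous_trigsum sin n p (@continuous_sin R).
by move=> x; apply: cvgD; [apply: cvgM; exact: cc|apply: cvgM; exact: cs].
Qed.

(** Real coefficients make conjugation act as [t -> - t]; integrals over [[- a, a]] then fold onto
    [[0, a]]. *)
Lemma sqtrig_even n p t : sqtrig n p (- t) = sqtrig n p t.
Proof.
rewrite /sqtrig; congr (_ ^+ 2 + _); first by apply: eq_bigr => k _; rewrite mulNr cosN.
rewrite -[RHS]sqrrN -sumrN; congr (_ ^+ 2).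
by apply: eq_bigr => k _; rewrite mulNr sinN mulrN.
Qed.

Lemma sin_2pin k : sin (k%:R * (2 * pi)) = 0 :> R.
Proof.
have -> : 2 * pi = pi *+ 2 :> R by rewrite mulr_natl.
elim: k => [|k ih]; first by rewrite mul0r sin0.
by rewrite -natr1 mulrDl mul1r sinD2pi.
Qed.

Lemma itg_cos_diff (j k : nat) :
  itg 0 (2 * pi) (fun t : R => cos ((j%:R - k%:R) * t)) = 2 * pi * (j == k)%:R.
Proof.
have p2 : 0 <= 2 * pi :> R by rewrite mulr_ge0 // pi_ge0.
case: eqVneq => [->|jk].
  rewrite (@eq_itg _ _ _ _ (cst 1)) => [|x _]; last by rewrite subrr mul0r cos0.
  by rewrite itg_cst // mul1r subr0 mulr1.
rewrite itg_cos //; last by rewrite subr_eq0 eqr_nat.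
by rewrite mulrBl sinB !sin_2pin mul0r mulr0 subr0 mul0r mulr0.
Qed.

Lemma parseval n p :
  itg 0 (2 * pi) (sqtrig n p) = 2 * pi * \sum_(k < n) p`_k ^+ 2.
Proof.
transitivity (itg 0 (2 * pi) (fun t => \sum_(j < n) \sum_(k < n)
    (p`_j * p`_k) * cos ((j%:R - k%:R) * t))).
  apply: eq_itg => t _; rewrite /sqtrig !expr2 !mulr_suml -big_split /=.
  apply: eq_bigr => j _; rewrite !mulr_sumr -big_split /=.
  apply: eq_bigr => k _; rewrite [_ * t]mulrC mulrBr cosB; ring.
have bc (j k : 'I_n) : bmeas (fun t => p`_j * p`_k * cos ((j%:R - k%:R) * t)).
  by apply: bmeasZ; exact: bmeas_cos.
rewrite itg_sum => [|j]; last exact: bmeas_sum.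
rewrite mulr_sumr; apply: eq_bigr => j _.
rewrite itg_sum // (bigD1 j) //= big1 ?addr0 => [|k kj].
  by rewrite itgZ ?itg_cos_diff ?eqxx ?mulr1 1?mulrC //; exact: bmeas_cos.
rewrite itgZ; last exact: bmeas_cos.
by rewrite itg_cos_diff eq_sym (_ : (k == j :> nat) = false) ?mulr0 //; apply/negbTE.
Qed.

(* Cauchy-Schwarz: a lower bound for the sum of the squares of the binomial
   coefficients that does not need their values. *)
Lemma horner_N1_le n p : (size p <= n)%N ->
  p.[-1] ^+ 2 <= n%:R * \sum_(k < n) p`_k ^+ 2.
Proof.
move=> pn; rewrite (horner_coef_wide _ pn).
have H := @quad_CS R (\sum_(k < n) p`_k ^+ 2) (\sum_(k < n) p`_k * (-1) ^+ k) n%:R.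
rewrite mulrC; apply: H => // [|t]; first by apply: sumr_ge0 => k _; exact: sqr_ge0.
apply: (@le_trans _ _ (\sum_(k < n) (p`_k - t * (-1) ^+ k) ^+ 2)).
  by apply: sumr_ge0 => k _; exact: sqr_ge0.
rewrite le_eqVlt; apply/orP; left; apply/eqP.
have -> : t ^+ 2 * n%:R = \sum_(k < n) t ^+ 2.
  by rewrite sumr_const card_ord mulr_natr.
rewrite mulr_sumr -sumrB -big_split /=; apply: eq_bigr => k _.
have : ((-1 : R) ^+ k) ^+ 2 = 1 by rewrite sqrr_sign.
move=> e; rewrite sqrrB exprMn e; ring.
Qed.

End TrigPolynomials.

(** * Cosine bumps *)

Section Bumps.
Context (R : realType).
Implicit Types (f g : R -> R) (a b t u x : R).

Lemma itg_indic a b f : -1 <= a -> b <= 1 ->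
  itg (-1) 1 (fun x => \1_(`[a, b]%classic : set R) x * f x) = itg a b f.
Proof.
move=> a1 b1; rewrite /itg.
have -> : (fun x => \1_(`[a, b]%classic : set R) x * f x) = f \_ `[a, b]%classic.
  by apply/funext => x; rewrite patchE indicE; case: (_ \in _); rewrite ?mul1r ?mul0r.
rewrite -Rintegral_mkcondr setIidr // => x /=; rewrite !in_itv /= => /andP[ax xb].
by rewrite (le_trans a1 ax) (le_trans xb b1).
Qed.

(** The function [A] of the overview; it is real because the half-period of the cosine is even. *)
Definition cospi_hat (s : R) : R :=
  itg (- 2^-1) 2^-1 (fun u => cos (pi * u) * cos (s * u)).

Lemma continuous_cosZ r : continuous (fun u : R => cos (r * u)).
Proof.
move=> x; apply: continuous_comp; last exact: continuous_cos.
by apply: cvgM; [exact: cvg_cst|exact: cvg_id].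
Qed.

Lemma continuous_sinZ r : continuous (fun u : R => sin (r * u)).
Proof.
move=> x; apply: continuous_comp; last exact: continuous_sin.
by apply: cvgM; [exact: cvg_cst|exact: cvg_id].
Qed.

(** The square of the cosine is [(1 + cos (2 * pi * u)) / 2], and the oscillating term runs over a
    full period. The same number is the squared norm of a bump on the unit scale. *)
Lemma cospi_hat_pi : cospi_hat pi = 2^-1.
Proof.
have p0 := pi_gt0 R.
rewrite /cospi_hat (@eq_itg _ _ _ _ (fun u => 2^-1 * (1 + cos ((2 * pi) * u)))); last first.
  move=> u _; rewrite (_ : 2 * pi * u = pi * u + pi * u); last by ring.
  by rewrite cosD; have := cos2Dsin2 (pi * u); rewrite !expr2; lra.
have b2 := bmeas_cos (2 * pi : R).
rewrite itgZ; last by apply: bmeasD => //; exact: bmeas_cst.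
rewrite itgD //; last exact: bmeas_cst.
rewrite itg_cst ?(itg_even _ (@continuous_cosZ _) b2) ?itg_cos //; try lra.
- rewrite (_ : 2 * pi / 2 = pi); last by field.
  by rewrite sinpi mul0r mulr0 addr0 opprK; field.
- by move=> x; rewrite mulrN cosN.
Qed.

(* For [|u| <= 1/2] and [0 <= s <= pi], [cos (s * u) >= cos (pi * u) >= 0]. *)
Lemma cospi_hat_ge s : 0 <= s <= pi -> 2^-1 <= cospi_hat s.
Proof.
move=> /andP[s0 sp]; rewrite -cospi_hat_pi.
have bb r : bmeas (fun u : R => cos (pi * u) * cos (r * u)).
  by apply: bmeasM; exact: bmeas_cos.
apply: le_itg => // u /andP[u1 u2].
have p0 := pi_gt0 R.
have pu : pi * `|u| <= pi / 2 by rewrite ler_pM2l // ler_norml u1.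
have cosabs r : 0 <= r -> cos (r * u) = cos (r * `|u|).
  by move=> r0; rewrite -[in RHS](ger0_norm r0) -normrM; case: (ler0P (r * u)); rewrite ?cosN.
rewrite !(cosabs pi) ?(ltW p0) // (cosabs s) //.
have u0 : 0 <= `|u| by [].
have su : s * `|u| <= pi * `|u| by rewrite ler_wpM2r.
apply: ler_wpM2l.
  apply: cos_ge0_pihalf; rewrite pu andbT (@le_trans _ _ 0) ?mulr_ge0 ?(ltW p0) //.
  by rewrite oppr_le0 divr_ge0 // ltW.
have su0 : 0 <= s * `|u| by rewrite mulr_ge0.
have pp : pi / 2 <= pi :> R by rewrite ler_pdivrMr // ler_peMr ?(ltW p0) // ler1n.
have pu0 : 0 <= pi * `|u| := le_trans su0 su.
have sI : s * `|u| \in `[0, pi] by rewrite in_itv /= su0 (le_trans su (le_trans pu pp)).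
have pI : pi * `|u| \in `[0, pi] by rewrite in_itv /= pu0 (le_trans pu pp).
by rewrite leNgt ltr_cos // -leNgt.
Qed.

Variable n : nat.
Let h : R := 2 / n.+1%:R.
Let h0 : 0 < h. Proof. by rewrite divr_gt0. Qed.

(** Keeping [h * j] apart from the constant splits the phase [t * x_ j] into the monomial phase
    [h * t * j] and a phase common to all bumps. *)
Definition bump_center (j : 'I_n.+1) : R := h * j%:R + (h / 2 - 1).
Let x_ := bump_center.

Definition cosine_bump (j : 'I_n.+1) x : R :=
  \1_(`[x_ j - h / 2, x_ j + h / 2]%classic : set R) x * cos (pi * ((x - x_ j) / h)).

Let cospih (j : 'I_n.+1) x := cos (pi * ((x - x_ j) / h)).

Let continuous_cospih j : continuous (cospih j).
Proof.
move=> x; apply: continuous_comp; last exact: continuous_cos.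
apply: cvgM; first exact: cvg_cst.
apply: cvgM; last exact: cvg_cst.
by apply: cvgB; [exact: cvg_id|exact: cvg_cst].
Qed.

Let bmeas_cospih j : bmeas (cospih j).
Proof.
apply: (@bmeas_continuous _ _ 1) => [|x]; first exact: continuous_cospih.
by rewrite ler_norml cos_geN1 cos_le1.
Qed.

Lemma bmeas_bump j : bmeas (cosine_bump j).
Proof.
by apply: bmeasM; [apply: bmeas_indic; exact: measurable_itv|exact: (bmeas_cospih j)].
Qed.

(** The substitution [x = h * u + x_ j] maps [[-1/2, 1/2]] onto the support, which lies in [[-1, 1]]
    because [h * (j + 1) <= 2]. *)
Lemma itg_bump j g : continuous g -> bmeas g ->
  itg (-1) 1 (fun x => cosine_bump j x * g x) =
  h * itg (- 2^-1) 2^-1 (fun u => cos (pi * u) * g (h * u + x_ j)).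
Proof.
move=> cg bg.
have hn : h * n.+1%:R = 2 by rewrite /h divfK.
have jn : (j%:R + 1 : R) <= n.+1%:R by rewrite natr1 ler_nat.
have j0 : 0 <= h * j%:R by rewrite mulr_ge0 // ltW.
have hj : h * (j%:R + 1) <= 2 by rewrite -hn ler_pM2l.
transitivity (itg (x_ j - h / 2) (x_ j + h / 2) (fun x => cospih j x * g x)).
  rewrite -[RHS]itg_indic.
  - by apply: eq_itg => x _; rewrite mulrA.
  - rewrite /x_ /bump_center; lra.
  - rewrite /x_ /bump_center; lra.
have -> : x_ j - h / 2 = h * (- 2^-1) + x_ j by rewrite mulrN addrC.
have -> : x_ j + h / 2 = h * 2^-1 + x_ j by rewrite addrC.
rewrite itg_affine //; [|lra| |exact: bmeasM].
  congr (_ * _); apply: eq_itg => u _; rewrite /cospih addrK [h * u]mulrC mulfK //.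
  by rewrite gt_eqF.
by move=> x; apply: cvgM; [exact: continuous_cospih|exact: cg].
Qed.

Lemma ip_bump j : ip (cosine_bump j) (cosine_bump j) = h / 2.
Proof.
rewrite /ip (@eq_itg _ _ _ _ (fun x => cosine_bump j x * cospih j x)) => [|x _].
  rewrite itg_bump; [|exact: continuous_cospih|exact: (bmeas_cospih j)].
  congr (_ * _); rewrite -[RHS]cospi_hat_pi; apply: eq_itg => u _.
  by rewrite /cospih addrK [h * u]mulrC mulfK // gt_eqF.
rewrite /cosine_bump -/(cospih j x) indicE.
by case: (_ \in _); rewrite ?mul1r ?mul0r ?mulr0.
Qed.

(** The closed supports of neighbours share an endpoint, but the cosine vanishes there, so the
    product is 0 everywhere. *)
Lemma bump_disjoint (j k : 'I_n.+1) x : (j < k)%N -> cosine_bump j x * cosine_bump k x = 0.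
Proof.
move=> jk; rewrite /cosine_bump !indicE.
case xj : (x \in `[x_ j - h / 2, x_ j + h / 2]%classic); last by rewrite !mul0r.
case xk : (x \in `[x_ k - h / 2, x_ k + h / 2]%classic); last by rewrite mul0r mulr0.
move: (set_mem xj) (set_mem xk) => /=; rewrite !in_itv /= => {xj} /andP[_ xj] {xk} /andP[xk _].
have jk' : h * (j%:R + 1) <= h * k%:R by rewrite ler_pM2l // natr1 ler_nat.
have -> : x = x_ k - h / 2.
  by apply/le_anti; rewrite xk andbT; apply: le_trans xj _; rewrite /x_ /bump_center; lra.
rewrite (_ : pi * ((x_ k - h / 2 - x_ k) / h) = - (pi / 2)).
  by rewrite cosN cos_pihalf !mulr0.
by field; rewrite gt_eqF.
Qed.

Lemma ip_bump0 j k : j != k -> ip (cosine_bump j) (cosine_bump k) = 0.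
Proof.
move=> jk; rewrite -(itg0 (-1) 1) /ip; apply: eq_itg => x _ /=.
have : (j : nat) != k by [].
by rewrite neq_ltn => /orP[|] ?; [|rewrite mulrC]; exact: bump_disjoint.
Qed.

(** The addition formula extracts the phase of the centre; the remaining sine integral vanishes by
    oddness. *)
Lemma cosT_bump j t : cosT (cosine_bump j) t = h * cospi_hat (h * t) * cos (t * x_ j).
Proof.
rewrite /cosT itg_bump; [|exact: continuous_cosZ|exact: bmeas_cos].
rewrite -mulrA; congr (_ * _).
have bc : bmeas (fun u : R => cos (pi * u) * cos (h * t * u)).
  by apply: bmeasM; exact: bmeas_cos.
have bs : bmeas (fun u : R => cos (pi * u) * sin (h * t * u)).
  by apply: bmeasM; [exact: bmeas_cos|exact: bmeas_sin].
transitivity (itg (- 2^-1) 2^-1 (fun u =>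
   cos (t * x_ j) * (cos (pi * u) * cos (h * t * u)) -
   sin (t * x_ j) * (cos (pi * u) * sin (h * t * u)))).
  apply: eq_itg => u _.
  by rewrite (_ : t * (h * u + x_ j) = h * t * u + t * x_ j) ?cosD; ring.
rewrite itgB; [|exact: bmeasZ..]; rewrite !itgZ // [X in _ - _ * X]itg_odd ?mulr0 ?subr0.
- exact: mulrC.
- lra.
- by move=> x; apply: cvgM; [exact: continuous_cosZ|exact: continuous_sinZ].
- exact: bs.
- by move=> u; rewrite !mulrN cosN sinN mulrN.
Qed.

Lemma sinT_bump j t : sinT (cosine_bump j) t = h * cospi_hat (h * t) * sin (t * x_ j).
Proof.
rewrite /sinT itg_bump; [|exact: continuous_sinZ|exact: bmeas_sin].
rewrite -mulrA; congr (_ * _).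
have bc : bmeas (fun u : R => cos (pi * u) * cos (h * t * u)).
  by apply: bmeasM; exact: bmeas_cos.
have bs : bmeas (fun u : R => cos (pi * u) * sin (h * t * u)).
  by apply: bmeasM; [exact: bmeas_cos|exact: bmeas_sin].
transitivity (itg (- 2^-1) 2^-1 (fun u =>
   sin (t * x_ j) * (cos (pi * u) * cos (h * t * u)) +
   cos (t * x_ j) * (cos (pi * u) * sin (h * t * u)))).
  apply: eq_itg => u _.
  by rewrite (_ : t * (h * u + x_ j) = h * t * u + t * x_ j) ?sinD; ring.
rewrite itgD; [|exact: bmeasZ..]; rewrite !itgZ // [X in _ + _ * X]itg_odd ?mulr0 ?addr0.
- exact: mulrC.
- lra.
- by move=> x; apply: cvgM; [exact: continuous_cosZ|exact: continuous_sinZ].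
- exact: bs.
- by move=> u; rewrite !mulrN cosN sinN mulrN.
Qed.

Variable v : 'rV[R]_n.+1.
Let f x : R := \sum_i v 0 i * cosine_bump i x.

Let bmeas_vbump i : bmeas (fun x => v 0 i * cosine_bump i x).
Proof. by apply: bmeasZ; exact: bmeas_bump. Qed.

Lemma ip_bump_sum : ip f f = h / 2 * \sum_i v 0 i ^+ 2.
Proof.
have bf : bmeas f by exact: bmeas_sum.
rewrite ip_sum // mulr_sumr; apply: eq_bigr => i _.
rewrite ipC ip_sum // (bigD1 i) //= big1 ?addr0 => [|k ki].
  transitivity (v 0 i ^+ 2 * ip (cosine_bump i) (cosine_bump i)); last by rewrite ip_bump mulrC.
  rewrite /ip -itgZ; last by apply: bmeasM; exact: bmeas_bump.
  by apply: eq_itg => x _; ring.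
transitivity (v 0 k * v 0 i * ip (cosine_bump k) (cosine_bump i)); last by rewrite ip_bump0 ?mulr0.
rewrite /ip -itgZ; last by apply: bmeasM; exact: bmeas_bump.
by apply: eq_itg => x _; ring.
Qed.

(** The common phase [b] rotates the pair [(X, Y)] and preserves [X ^+ 2 + Y ^+ 2]. *)
Lemma trigT_bump_sum t : cosT f t ^+ 2 + sinT f t ^+ 2 =
  (h * cospi_hat (h * t)) ^+ 2 * sqtrig n.+1 (rVpoly v) (h * t).
Proof.
have E (s : R -> R) : (forall r, bmeas (fun x => s (r * x))) ->
    itg (-1) 1 (fun y => f y * s (t * y)) =
    \sum_i v 0 i * itg (-1) 1 (fun y => cosine_bump i y * s (t * y)).
  move=> bs; rewrite (@eq_itg _ _ _ _ (fun y => \sum_i v 0 i * (cosine_bump i y * s (t * y)))).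
    rewrite itg_sum => [|i]; last by apply/bmeasZ/bmeasM => //; exact: bmeas_bump.
    by apply: eq_bigr => i _; rewrite itgZ //; apply: bmeasM => //; exact: bmeas_bump.
  by move=> y _; rewrite mulr_suml; apply: eq_bigr => i _; rewrite mulrA.
pose X := \sum_(k < n.+1) (rVpoly v)`_k * cos (h * t * k%:R).
pose Y := \sum_(k < n.+1) (rVpoly v)`_k * sin (h * t * k%:R).
pose b := t * (h / 2 - 1).
have tx j : t * x_ j = h * t * j%:R + b by rewrite /x_ /bump_center /b; ring.
have -> : cosT f t = h * cospi_hat (h * t) * (X * cos b - Y * sin b).
  rewrite /cosT E; last exact: bmeas_cos.
  rewrite /X /Y !mulr_suml -sumrB mulr_sumr; apply: eq_bigr => j _.
  by rewrite -/(cosT _ _) cosT_bump tx cosD coef_rVpoly_ord; ring.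
have -> : sinT f t = h * cospi_hat (h * t) * (X * sin b + Y * cos b).
  rewrite /sinT E; last exact: bmeas_sin.
  rewrite /X /Y !mulr_suml -big_split mulr_sumr; apply: eq_bigr => j _.
  by rewrite -/(sinT _ _) sinT_bump tx sinD coef_rVpoly_ord /=; ring.
rewrite /sqtrig -/X -/Y !exprMn -mulrDr; congr (_ * _).
have := cos2Dsin2 b; set C := cos b; set S := sin b => e.
transitivity ((X ^+ 2 + Y ^+ 2) * (C ^+ 2 + S ^+ 2)); first by ring.
by rewrite e mulr1.
Qed.

(** On [[0, c]] one has [h * t <= pi], so [cospi_hat] is at least 1/2. The constant is
    [1/pi * (h/2)^2], divided by [h] for the substitution and by 2 for the folding. *)
Lemma Qop_bump_sum c : 0 <= c -> h * c <= pi ->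
  h / (8 * pi) * itg (- (h * c)) (h * c) (sqtrig n.+1 (rVpoly v)) <= ip (Qop c f) f.
Proof.
move=> c0 hc; have p0 := pi_gt0 R; have bf : bmeas f by exact: bmeas_sum.
set p := rVpoly v.
have bp := bmeas_sqtrig n.+1 p; have cp := @continuous_sqtrig _ n.+1 p.
have hc0 : 0 <= h * c by rewrite mulr_ge0 // ltW.
rewrite ip_Qop // (itg_even hc0 cp bp (@sqtrig_even _ _ _)).
have -> : itg 0 (h * c) (sqtrig n.+1 p) = h * itg 0 c (fun t => sqtrig n.+1 p (h * t)).
  have := @itg_affine _ h 0 0 c _ h0 c0 cp bp; rewrite mulr0 !addr0 => ->.
  by congr (_ * _); apply: eq_itg => t _; rewrite addr0.
have bph : bmeas (fun t => sqtrig n.+1 p (h * t)).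
  have [_ [B pB]] := bp; apply: (@bmeas_continuous _ _ B) => [x|x]; last exact: pB.
  apply: (@continuous_comp _ _ _ (fun t => h * t)); last exact: cp.
  by apply: cvgM; [exact: cvg_cst|exact: cvg_id].
have gen (q r I : R) : q != 0 ->
    r / (8 * q) * (2 * (r * I)) = q^-1 * ((r / 2) ^+ 2 * I) by move=> q0; field.
rewrite gen; last by rewrite gt_eqF.
rewrite ler_pM2l ?invr_gt0 // -itgZ //.
have [bC bS] := (bmeas_cosT bf, bmeas_sinT bf).
apply: le_itg => [||t /andP[t0 tc]]; first exact: bmeasZ.
  by apply: bmeasD; exact: bmeasM.
rewrite -!expr2 trigT_bump_sum -/p ler_wpM2r //.
  by rewrite /sqtrig addr_ge0 ?sqr_ge0.
have A2 : 2^-1 <= cospi_hat (h * t).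
  apply: cospi_hat_ge; rewrite mulr_ge0 ?(ltW h0) //=.
  by apply: le_trans hc; rewrite ler_pM2l.
have A0 : 0 <= cospi_hat (h * t) by apply: le_trans A2; lra.
rewrite ler_pXn2r ?nnegrE ?mulr_ge0 ?(ltW h0) //.
by rewrite ler_pM2l.
Qed.

End Bumps.

(** * The bounds *)

Section Bounds.
Context (R : realType).
Implicit Types (c eps C : R) (n : nat).

Definition turan_const n eps : set R :=
  [set C | forall P : {poly R[i]}, (size P <= n.+1)%N -> forall a : R,
    C * itg 0 (2 * pi) (sqnorm_circle P) <= itg a (a + eps) (sqnorm_circle P)].

(** Testing on real coefficients suffices for upper bounds on the constant, and Parseval turns the
    full integral into a sum of squares. *)
Lemma turan_const_sqtrig n eps C (p : {poly R}) a : turan_const n eps C ->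
  (size p <= n.+1)%N ->
  C * (2 * pi * \sum_(k < n.+1) p`_k ^+ 2) <= itg a (a + eps) (sqtrig n.+1 p).
Proof.
move=> CG pn; have := CG (map_poly (real_complex R) p).
rewrite size_map_poly => /(_ pn a).
have E t : sqnorm_circle (map_poly (real_complex R) p) t = sqtrig n.+1 p t.
  exact: sqnorm_circle_real.
by rewrite (funext E) parseval.
Qed.

Lemma Gamma2_le n eps B : 0 <= B ->
  (forall C, 0 < C -> turan_const n eps C -> C <= B) -> Gamma2 n eps <= B.
Proof.
move=> B0 H; rewrite /Gamma2; apply: ge_sup.
  (* The constant 0 is admissible, so the supremum is taken over a nonempty set. *)
  exists 0 => P _ a; rewrite mul0r; apply: Rintegral_ge0 => t _.
  exact: sqr_ge0.
by move=> C CG; have [C0|C0] := leP C 0; [exact: le_trans B0|exact: H].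
Qed.

Lemma Gamma2_le_lambda c n : 0 < c -> 2 * c / pi - 1 <= n%:R ->
  Gamma2 n (4 * c / n.+1%:R) <= 2 * lambda c n.
Proof.
move=> c0 cn; have p0 := pi_gt0 R; have c0' := ltW c0.
apply: Gamma2_le => [|C C0 CG]; first by rewrite mulr_ge0 // lambda_ge0.
rewrite -ler_pdivrMl // mulrC.
pose h : R := 2 / n.+1%:R.
have h0 : 0 < h by rewrite divr_gt0.
(* The hypothesis on [n] says exactly this. *)
have hc : h * c <= pi.
  rewrite /h mulrAC ler_pdivrMr // [pi * _]mulrC.
  by move: cn; rewrite lerBlDr natr1 ler_pdivrMr.
apply: (@lambda_minmax _ _ c0' n _ (@cosine_bump R n)).
- by rewrite divr_gt0.
- exact: bmeas_bump.
move=> v v0; rewrite /= ip_bump_sum -/h.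
have s0 : 0 < \sum_i v 0 i ^+ 2.
  rewrite lt_neqAle sumr_ge0 ?andbT => [|i _]; last exact: sqr_ge0.
  rewrite eq_sym psumr_eq0 => [|i _]; last exact: sqr_ge0.
  apply: contraNN v0 => /allP v0; apply/eqP/rowP => i; rewrite mxE.
  by have := v0 i (mem_index_enum _); rewrite /= sqrf_eq0 => /eqP.
split; first by rewrite mulr_gt0 // divr_gt0.
apply: le_trans (Qop_bump_sum v c0' hc); rewrite -/h.
(* The interval [[- (h * c), h * c]] has length [4 * c / (n + 1)]. *)
have := @turan_const_sqtrig _ _ _ (rVpoly v) (- (h * c)) CG (size_poly _ _).
have -> : - (h * c) + 4 * c / n.+1%:R = h * c.
  by rewrite /h; set q := n.+1%:R^-1; ring.
have -> : \sum_(k < n.+1) (rVpoly v)`_k ^+ 2 = \sum_i v 0 i ^+ 2.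
  by apply: eq_bigr => i _; rewrite coef_rVpoly_ord.
set s := \sum_i _; set J := itg _ _ _ => CJ.
have hp : 0 < h / (8 * pi) by rewrite divr_gt0 // mulr_gt0.
have := CJ; rewrite -(ler_pM2l hp); apply: le_trans.
have gen (q r : R) : q != 0 -> C / 2 * (r / 2 * s) = r / (8 * q) * (C * (2 * q * s)).
  by move=> q0; field.
by rewrite -gen // gt_eqF.
Qed.

(** * The powers of [X - 1] and the exponential bound *)

Lemma sqnorm_circle_pow n (t : R) :
  sqnorm_circle (('X - 1) ^+ n : {poly R[i]}) t = (2 - 2 * cos t) ^+ n.
Proof.
rewrite /sqnorm_circle horner_exp hornerD hornerX hornerN hornerC.
set z := _ - 1.
have -> : Normc.normc (z ^+ n) = Normc.normc z ^+ n.
  by elim: n => [|m ih]; rewrite ?expr0 ?Normc.normc1 // !exprS Normc.normcM ih.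
rewrite exprAC; congr (_ ^+ n).
rewrite /z /= sqr_sqrtr ?addr_ge0 ?sqr_ge0 //.
by have := cos2Dsin2 t; rewrite !expr2; lra.
Qed.

(** The factor [n + 1] lost in [horner_N1_le] is absorbed by the gain [87 / 100] of [sin_sqr_le];
    this is where [33 <= n] enters. *)
Lemma geometric_bound n : (33 <= n)%N -> n.+1%:R * (87 / 100) ^+ n <= 1 :> R.
Proof.
(* The existential makes [q] opaque. For [n = 33], its powers are bounded by repeated squaring with
   upward rounding. *)
have [q qE] : exists q : R, q = 87 / 100 by exists (87 / 100).
rewrite -qE; have q0 : 0 < q by rewrite qE; lra.
elim: n => // n ih; rewrite leq_eqVlt => /predU1P[<-|n33].
  have q2 : q ^+ 2 <= 757 / 1000 by rewrite qE; lra.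
  have mono (k : nat) (a b : R) : 0 <= a -> q ^+ k <= a -> a * a <= b -> q ^+ (k + k) <= b.
    move=> a0 ka ab; apply: le_trans ab; rewrite exprD; apply: ler_pM => //; exact/exprn_ge0/ltW.
  have q4 : q ^+ 4 <= 575 / 1000 by apply: (mono 2%N _ _ _ q2); lra.
  have q8 : q ^+ 8 <= 332 / 1000 by apply: (mono 4%N _ _ _ q4); lra.
  have q16 : q ^+ 16 <= 111 / 1000 by apply: (mono 8%N _ _ _ q8); lra.
  have q32 : q ^+ 32 <= 13 / 1000 by apply: (mono 16%N _ _ _ q16); lra.
  rewrite exprS qE; move: q32; rewrite qE; lra.
apply: le_trans (ih n33); rewrite exprS mulrA ler_pM2r ?exprn_gt0 //.
have : (33 : R) <= n%:R by rewrite ler_nat.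
by rewrite -[n.+2%:R]natr1 -[n.+1%:R]natr1 qE; lra.
Qed.

(** One factor [|sin u|] is at most [x]. The other is at most [sqrt 3 / 2 < 87 / 100], since the
    half-angle formula gives [cos u >= 1/2] for [|u| <= 1]. *)
Lemma sin_sqr_le (x u : R) : 0 < x -> x < 1 -> `|u| <= x ->
  sin u ^+ 2 <= x * (87 / 100).
Proof.
move=> x0 x1 ux.
have su : `|sin u| <= x by apply: le_trans ux; exact: sin_le_abs.
have cu : 2^-1 <= cos u.
  have -> : u = u / 2 + u / 2 by rewrite -splitr.
  rewrite cosD; have := cos2Dsin2 (u / 2).
  have : `|sin (u / 2)| <= 2^-1.
    by apply: le_trans (sin_le_abs _) _; rewrite normrM [`|2^-1|]ger0_norm //; lra.
  rewrite ler_norml => /andP[]; rewrite !expr2; nra.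
have s34 : `|sin u| <= 87 / 100.
  have : sin u ^+ 2 <= 3 / 4 by have := cos2Dsin2 u; rewrite !expr2; nra.
  by rewrite ler_norml => ?; apply/andP; split; nra.
rewrite -(real_normK (num_real _)) expr2; exact: ler_pM.
Qed.

Lemma Gamma2_le_exp n eps : 0 < eps -> eps < 4 -> (33 <= n)%N ->
  Gamma2 n eps <= expR (- (n%:R / 32 * ln (4 / eps))).
Proof.
move=> e0 e4 n33; apply: Gamma2_le => [|C C0 CG]; first exact: expR_ge0.
pose x : R := eps / 4.
have x0 : 0 < x by rewrite divr_gt0.
have x1 : x < 1 by rewrite ltr_pdivrMr // mul1r.
(* The stronger bound [(eps / 4) ^+ n] is what gets proved; as [ln x <= 0], dividing the exponent by
   32 only weakens it. *)
apply: (@le_trans _ _ (x ^+ n)); last first.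
  have -> : ln (4 / eps) = - ln x by rewrite -lnV ?posrE // /x invf_div.
  rewrite mulrN opprK -{1}(lnK (x0 : x \is Num.pos)) -expRM_natl ler_expR.
  have lx : ln x <= 0 by apply: ln_le0; exact: ltW.
  have n0 : 0 <= n%:R :> R by [].
  nra.
pose p : {poly R} := ('X - 1) ^+ n.
have sp : size p = n.+1.
  by rewrite /p -[1]/(1%:P) size_exp_XsubC.
have := turan_const_sqtrig (p := p) (- (eps / 2)) CG _; rewrite sp => /(_ (leqnn _)).
have E t : sqtrig n.+1 p t = (2 - 2 * cos t) ^+ n.
  rewrite -sqnorm_circle_real ?sp // -sqnorm_circle_pow /p rmorphXn rmorphB /=.
  by rewrite map_polyX rmorph1.
have q0 : 0 <= 87 / 100 :> R by lra.
have : itg (- (eps / 2)) (- (eps / 2) + eps) (sqtrig n.+1 p) <= eps * (4 * (x * (87 / 100))) ^+ n.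
  have -> : eps * (4 * (x * (87 / 100))) ^+ n =
      (4 * (x * (87 / 100))) ^+ n * (- (eps / 2) + eps - - (eps / 2)).
    rewrite [LHS]mulrC; congr (_ * _); lra.
  rewrite -itg_cst; last by lra.
  apply: le_itg; [exact: bmeas_sqtrig|exact: bmeas_cst|].
  move=> t /andP[t1 t2]; rewrite E /=.
  have -> : 2 - 2 * cos t = 4 * sin (t / 2) ^+ 2.
    have {1}-> : t = t / 2 + t / 2 by rewrite -splitr.
    by rewrite cosD; have := cos2Dsin2 (t / 2); rewrite !expr2; lra.
  have sn0 : 0 <= 4 * sin (t / 2) ^+ 2 by have := sqr_ge0 (sin (t / 2)); lra.
  have xn0 : 0 <= 4 * (x * (87 / 100)) by lra.
  apply: lerXn2r; rewrite ?nnegrE //.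
  rewrite ler_pM2l //; apply: sin_sqr_le => //.
  by rewrite /x ler_norml; apply/andP; split; lra.
move=> h1 h2; have {h1 h2} := le_trans h2 h1.
set s := \sum_(k < _) _.
(* The value of [p] at -1 is [(-2) ^+ n], of square [4 ^+ n]. *)
have : 4 ^+ n <= n.+1%:R * s.
  have := @horner_N1_le _ n.+1 p; rewrite sp => /(_ (leqnn _)).
  rewrite /p horner_exp hornerD hornerX hornerN hornerC exprAC.
  by rewrite (_ : (-1 - 1) ^+ 2 = 4 :> R) //; ring.
(* From [eps < 4 <= 2 * pi], the length of the interval cancels against the factor [2 * pi] of
   Parseval. *)
have p2 := pi_ge2 R.
have n1 : 0 < n.+1%:R :> R by [].
rewrite [(4 * _) ^+ n]exprMn [(x * _) ^+ n]exprMn; move: (geometric_bound n33).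
set Q := (87 / 100) ^+ n; set F := 4 ^+ n; set X := x ^+ n; set N := n.+1%:R in n1 *.
move=> NQ FN H.
have F0 : 0 < F by rewrite exprn_gt0.
have X0 : 0 < X by rewrite exprn_gt0.
have Q0 : 0 < Q by rewrite exprn_gt0 //; lra.
rewrite -(ler_pM2r F0).
apply: (@le_trans _ _ (C * (N * s))); first by rewrite ler_pM2l.
have s0 : 0 < s by rewrite -(pmulr_rgt0 _ n1); apply: lt_le_trans F0 FN.
have h3 : C * (4 * s) <= 4 * (F * (X * Q)).
  apply: (@le_trans _ _ (C * (2 * pi * s))).
    rewrite ler_pM2l // ler_pM2r //; lra.
  apply: le_trans H _; rewrite ler_pM2r //; first exact: ltW.
  by rewrite !mulr_gt0.
have h4 : C * s <= F * (X * Q) by lra.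
have h5 : N * (C * s) <= N * (F * (X * Q)) by rewrite ler_pM2l.
have h6 : N * Q * (F * X) <= 1 * (F * X) by rewrite ler_pM2r // mulr_gt0.
have -> : C * (N * s) = N * (C * s) by ring.
apply: (le_trans h5); move: h6; rewrite mul1r [X * F]mulrC.
by congr (_ <= _); ring.
Qed.

End Bounds.

Theorem proposition5p1 (R : realType) :
  (forall (c : R) (n : nat), 0 < c -> 2 * c / pi - 1 <= n%:R ->
     Gamma2 n (4 * c / n.+1%:R) <= 2 * lambda c n) /\
  (forall (n : nat) (eps : R), 0 < eps -> eps < 2 * pi ->
     Gamma2 n eps <= 2 * lambda (n.+1%:R / 4 * eps) n) /\
  (forall (n : nat) (eps : R), 0 < eps -> eps < 4 -> (33 <= n)%N ->
     Gamma2 n eps <= expR (- (n%:R / 32 * ln (4 / eps)))).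
Proof.
split; first by move=> c n; exact: Gamma2_le_lambda.
split=> [n eps e0 e2|n eps]; last exact: Gamma2_le_exp.
have p0 := pi_gt0 R; have n0 : 0 < n.+1%:R :> R by [].
have c0 : 0 < n.+1%:R / 4 * eps by rewrite mulr_gt0 // divr_gt0.
(* With [c = (n + 1) * eps / 4], the condition [2 * c / pi - 1 <= n] amounts to [eps <= 2 * pi]. *)
rewrite [X in Gamma2 n X](_ : eps = 4 * (n.+1%:R / 4 * eps) / n.+1%:R).
  apply: Gamma2_le_lambda => //.
  rewrite lerBlDr natr1 ler_pdivrMr //.
  have h : n.+1%:R * eps <= n.+1%:R * (2 * pi) by rewrite ler_pM2l // ltW.
  lra.
have gen (q : R) : q != 0 -> eps = 4 * (q / 4 * eps) / q by move=> q0; field.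
by apply: gen; rewrite gt_eqF.
Qed.
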